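(* For a positive integer $n$, a regular drawing of the complete graph $K_n$ contains a $5$-face if and only if $n \notin \{1,2,3,4,6,8,12\}$.
   Context: A rectilinear drawing $D$ of $K_n$ represents the vertices of $K_n$ by $n$ distinct points in the plane $\mathbb{R}^2$, no three of which lie on a common line, and represents each edge by the line segment connecting the points representing its end-vertices. The drawing $D$ is regular if the points representing the vertices are the vertices of a regular convex $n$-gon (for $n = 1$ and $n=2$ this is understood as a single point, respectively two distinct points, and the drawing then has no bounded face). Identify $D$ with the union of its points and segments. A face of $D$ is a non-empty connected component of $\mathbb{R}^2 \setminus D$. Exactly one face is unbounded, and every bounded face is (the interior of) a convex polygon; the size of a bounded face is the number of vertices (corners) of this polygon. A bounded face of size $k$ is called a $k$-face of $D$. *)

(* Defs.v *)
From HB Require Import structures.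
From mathcomp Require Import all_boot all_order all_algebra.
From mathcomp Require Import all_classical all_reals all_analysis.

Set Implicit Arguments.
Unset Strict Implicit.
Unset Printing Implicit Defensive.

Import Order.TTheory GRing.Theory Num.Theory.
Import numFieldNormedType.Exports.

Local Open Scope classical_set_scope.
Local Open Scope ring_scope.

Definition plane_line (R : realType) (a d : R * R) : set (R * R) :=
  [set a + t *: d | t in setT].

Definition collinear (R : realType) (A : set (R * R)) : Prop :=
  exists a d : R * R, d != 0 /\ A `<=` plane_line a d.

Definition segment (R : realType) (a b : R * R) : set (R * R) :=
  [set (1 - t) *: a + t *: b | t in [set t : R | 0 <= t <= 1]].

Definition conv_hull (R : realType) (A : set (R * R)) : set (R * R) :=
  smallest (@convex_set R (R * R)%type) A.

(* p i is the point representing the i-th vertex of K_n. *)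
Definition rectilinear_drawing (R : realType) (n : nat) (p : 'I_n -> R * R) :
    Prop :=
  injective p /\
  forall i j k : 'I_n, i != j -> j != k -> i != k ->
    ~ collinear [set p i; p j; p k].

Definition regular_ngon (R : realType) (n : nat) (c : R * R) (r theta : R)
    (i : 'I_n) : R * R :=
  (c.1 + r * cos (theta + 2 * pi * i%:R / n%:R),
   c.2 + r * sin (theta + 2 * pi * i%:R / n%:R)).

(* For n = 1 this allows an arbitrary point, and for n = 2 an arbitrary pair of
   distinct points (c is their midpoint). *)
Definition regular_drawing (R : realType) (n : nat) (p : 'I_n -> R * R) :
    Prop :=
  rectilinear_drawing p /\
  exists (c : R * R) (r theta : R),
    0 < r /\ range p = range (@regular_ngon R n c r theta).

Definition drawing_set (R : realType) (n : nat) (p : 'I_n -> R * R) :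
    set (R * R) :=
  range p `|`
  \bigcup_(e in [set e : 'I_n * 'I_n | e.1 != e.2]) segment (p e.1) (p e.2).

Definition faces (R : realType) (D : set (R * R)) : set (set (R * R)) :=
  connected_component (~` D) @` (~` D).

(* v enumerates the corners of the convex polygon P: no v i lies in the convex
   hull of the others (in particular v is injective). *)
Definition convex_polygon (R : realType) (k : nat) (v : 'I_k -> R * R)
    (P : set (R * R)) : Prop :=
  (forall i, ~ conv_hull (v @` [set j | j != i]) (v i)) /\
  P = conv_hull (range v).

(* Degenerate polygons (k < 3) have empty interior, hence bound no face. *)
Definition k_face (R : realType) (k : nat) (D F : set (R * R)) : Prop :=
  [/\ faces D F, bounded_set F &
      exists (v : 'I_k -> R * R) (P : set (R * R)),
        convex_polygon v P /\ F = interior P].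

(* Main.v *)
From Stdlib Require Import ZArith.
Require Import Defs.
From mathcomp Require Import all_boot all_order all_algebra.
From mathcomp Require Import all_classical all_reals all_analysis.
From mathcomp Require Import ring lra zify ssrZ.
Set Implicit Arguments.
Unset Strict Implicit.
Unset Printing Implicit Defensive.
Import Order.TTheory GRing.Theory Num.Theory.
Import numFieldNormedType.Exports.
Local Open Scope classical_set_scope.
Local Open Scope ring_scope.
Delimit Scope Z_scope with BZ.

(** A face exists or not depending on [n] for two rather different reasons.

    Existence.  Number the vertices cyclically and look near the side joining
    0 and 1.  Below the chord from -1 to 2, only the chords issued from 0 and
    from 1 are visible: any other chord has both ends beyond that chord.  Two
    consecutive chords from 0, to j and j+1, and two consecutive chords from
    1, to -i and -i-1, enclose a quadrilateral, and when the chord from -1 to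
    2 cuts off exactly its far corner, what remains is a pentagonal face
    ([pencil_pentagon]).  On which side of that chord the crossing of the
    chords (0, j) and (1, -i) lies is decided by the sign of
      sin((i-1)t) sin((j-2)t) - sin(t) sin((i+j)t),    t = pi/n,
    and for the few pairs (i, j) that are needed this expression factors so
    that its sign amounts to comparing 3t, 4t, 5t or 6t with a right angle or
    with pi/3 ([pentagon_exists]).  This covers every [n] for which a
    pentagon is expected, except 18, where 6t = pi/3 makes three chords
    concurrent.  For [n = 18] another pentagon is exhibited; its corners are
    located by a table of sines with guaranteed errors, and one exact
    concurrency is an identity between sines ([pentagon18]).

    Non-existence.  For [n] in 3, 4, 6, 8, 12 the vertices have coordinates in
    the ring Z[sqrt 3] or Z[sqrt 2], up to a factor 2.  Cutting the n-gon
    along all its chords with exact arithmetic produces only triangles and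
    quadrilaterals ([no_pentagon_small]).  The computation is trusted only at
    its leaves: the final cells are certified to be convex polygons with fewer
    than five corners which no chord crosses, and every bounded face is the
    interior of such a cell ([no_pentagon]).  Since the corners of a convex
    polygon are determined by its interior ([convex_polygon_size]), no face is
    a pentagon.  For one or two points the drawing lies on a segment and has
    no bounded face ([segment_no_face]).

    Both directions rest on the description of a convex polygon by affine
    functions that vanish on its edges ([polygon]): if the edges belong to the
    drawing and the drawing misses the interior, that interior is a face
    ([polygon_k_face]). *)

(** * Convex sets and affine functions in the plane *)
Section Plane.
Variable R : realType.
Local Notation pt := (R * R)%type.
Implicit Types (A K : set pt) (f g : pt -> R) (x y z : pt) (t : R).

Definition cvx A :=
  forall x y t, 0 <= t <= 1 -> A x -> A y -> A ((1 - t) *: x + t *: y).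

Lemma cvxP A : convex_set A <-> cvx A.
Proof.
split=> cA x y t.
  move=> /andP[t0 t1] Ax Ay.
  have h0 : 0 <= 1 - t by lra.
  have h1 : 1 - t <= 1 by lra.
  have := cA x y (Itv01 h0 h1); rewrite !inE => /(_ Ax Ay).
  by rewrite /conv /= /unstable.onem opprB addrCA subrr addr0.
rewrite !inE => Ax Ay.
have h0 : 0 <= t%:num by [].
have h1 : t%:num <= 1 by [].
have := cA x y (1 - t%:num).
have -> : 0 <= 1 - t%:num <= 1 by apply/andP; split; lra.
move=> /(_ isT Ax Ay).
by have -> : 1 - (1 - t%:num) = t%:num by ring.
Qed.

Lemma sub_conv_hull A : A `<=` conv_hull A.
Proof. exact: sub_gen_smallest. Qed.

Lemma cvx_conv_hull A : cvx (conv_hull A).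
Proof.
move=> x y t t01 Ax Ay K [/cvxP cK AK].
by apply: (cK x y t t01); [apply: Ax | apply: Ay]; split=> //=; apply/cvxP.
Qed.

Lemma conv_hull_sub A K : cvx K -> A `<=` K -> conv_hull A `<=` K.
Proof. by move=> /cvxP cK AK; apply: smallest_sub. Qed.

Lemma cvx_segment A x y : cvx A -> A x -> A y -> segment x y `<=` A.
Proof. by move=> cA Ax Ay z [t t01 <-]; apply: cA. Qed.

Lemma segmentC x y : segment x y `<=` segment y x.
Proof.
move=> _ [t /= /andP[t0 t1] <-]; exists (1 - t); first by apply/andP; split; lra.
by rewrite subKr addrC.
Qed.

Lemma segment_cvx x y : cvx (segment x y).
Proof.
move=> _ _ t /andP[t0 t1] [u /= /andP[u0 u1] <-] [v /= /andP[v0 v1] <-].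
exists ((1 - t) * u + t * v); first by apply/andP; split; nra.
by case: x y => [x1 x2] [y1 y2]; congr pair; rewrite /= /GRing.scale /=; ring.
Qed.

Definition affine f := exists a b c, forall z, f z = a * z.1 + b * z.2 + c.

Lemma affineP f x y t : affine f ->
  f ((1 - t) *: x + t *: y) = (1 - t) * f x + t * f y.
Proof. by move=> [a [b [c fE]]]; rewrite !fE /= /GRing.scale /=; ring. Qed.

Lemma affine_ray f z d t : affine f ->
  f (z + t *: d) = f z + t * (f (z + d) - f z).
Proof. by move=> [a [b [c fE]]]; rewrite !fE /= /GRing.scale /=; ring. Qed.

Lemma affineN f : affine f -> affine (fun z => - f z).
Proof.
move=> [a [b [c fE]]]; exists (- a), (- b), (- c) => z.
by rewrite fE; ring.
Qed.

Lemma affineD f g : affine f -> affine g -> affine (fun z => f z + g z).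
Proof.
move=> [a [b [c fE]]] [a' [b' [c' gE]]].
by exists (a + a'), (b + b'), (c + c') => z; rewrite fE gE; ring.
Qed.

Lemma affine_continuous f : affine f -> continuous f.
Proof.
move=> [a [b [c fE]]]; have -> : f = (fun z => a * z.1 + b * z.2 + c).
  exact/funext.
move=> z; apply: cvgD; last exact: cvg_cst.
by apply: cvgD; apply: cvgM; (exact: cvg_cst || exact: cvg_fst || exact: cvg_snd).
Qed.

Lemma affine_open f : affine f -> open [set z | 0 < f z].
Proof.
move=> /affine_continuous fc.
by apply: (open_comp _ (@open_gt R 0)) => z _; exact: fc.
Qed.

Lemma affine_cvx_ge f : affine f -> cvx [set z | 0 <= f z].
Proof. by move=> fa x y t /andP[t0 t1] /= fx fy; rewrite affineP//; nra. Qed.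

Lemma affine_cvx_gt f : affine f -> cvx [set z | 0 < f z].
Proof. by move=> fa x y t /andP[t0 t1] /= fx fy; rewrite affineP//; nra. Qed.

Lemma affine_segment_le0 f x y z : affine f -> f x <= 0 -> f y <= 0 ->
  segment x y z -> f z <= 0.
Proof. by move=> fa fx fy [t /= /andP[t0 t1] <-]; rewrite affineP//; nra. Qed.

Lemma affine_segment_ge0 f x y z : affine f -> 0 <= f x -> 0 <= f y ->
  segment x y z -> 0 <= f z.
Proof. by move=> fa fx fy [t /= /andP[t0 t1] <-]; rewrite affineP//; nra. Qed.

Lemma affine_segment_eq0 f x y z : affine f -> f x = 0 -> f y = 0 ->
  segment x y z -> f z = 0.
Proof. by move=> fa fx fy [t _ <-]; rewrite affineP// fx fy; ring. Qed.

(** Two distinct zeros determine the zero line; [w] excludes constants. *)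
Lemma affine_zero_line f x y w z : affine f -> x != y -> f x = 0 -> f y = 0 ->
  f w != 0 -> f z = 0 -> exists t, z = (1 - t) *: x + t *: y.
Proof.
case: x y z w => [x1 x2] [y1 y2] [z1 z2] [w1 w2] [a [b [c fE]]].
rewrite !fE /= => xy ex ey ew ez.
have ab : (a != 0) || (b != 0).
  apply: contraNT ew; rewrite negb_or !negbK => /andP[/eqP a0 /eqP b0].
  by move: ex; rewrite a0 b0 !mul0r => ->.
have e1 : a * (y1 - x1) + b * (y2 - x2) = 0.
  by rewrite -[RHS](subrr 0) -{1}ey -ex; ring.
have e2 : a * (z1 - x1) + b * (z2 - x2) = 0.
  by rewrite -[RHS](subrr 0) -{1}ez -ex; ring.
have e3 : (y1 - x1) * (z2 - x2) = (y2 - x2) * (z1 - x1).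
  apply/eqP; rewrite -subr_eq0; apply/eqP.
  have [a0|a0] := eqVneq a 0.
    have b0 : b != 0 by move: ab; rewrite a0 eqxx.
    apply: (mulfI b0).
    have -> : b * ((y1 - x1) * (z2 - x2) - (y2 - x2) * (z1 - x1)) =
      (y1 - x1) * (a * (z1 - x1) + b * (z2 - x2))
      - (z1 - x1) * (a * (y1 - x1) + b * (y2 - x2)) by ring.
    by rewrite e1 e2; ring.
  apply: (mulfI a0).
  have -> : a * ((y1 - x1) * (z2 - x2) - (y2 - x2) * (z1 - x1)) =
      (z2 - x2) * (a * (y1 - x1) + b * (y2 - x2))
      - (y2 - x2) * (a * (z1 - x1) + b * (z2 - x2)) by ring.
  by rewrite e1 e2; ring.
have [d0|d0] := eqVneq y1 x1.
  have d1 : y2 - x2 != 0.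
    by apply: contra xy; rewrite subr_eq0 => /eqP ->; rewrite d0.
  exists ((z2 - x2) / (y2 - x2)).
  have : (y2 - x2) * (z1 - x1) = 0 by rewrite -e3 d0; ring.
  move/eqP; rewrite mulf_eq0 (negbTE d1) /= subr_eq0 => /eqP ->.
  congr pair => /=; rewrite ?d0 /GRing.scale /=; field; exact: d1.
have d1 : y1 - x1 != 0 by rewrite subr_eq0.
exists ((z1 - x1) / (y1 - x1)).
congr pair => /=; rewrite /GRing.scale /=; first by field.
have -> : z2 = x2 + (y2 - x2) * (z1 - x1) / (y1 - x1) by rewrite -e3; field.
by field.
Qed.

Lemma finite_open (n : nat) (E : 'I_n -> pt -> R) :
  (forall i, affine (E i)) -> open [set z | forall i, 0 < E i z].
Proof.
move=> Ea; rewrite openE => z Ez; rewrite /interior /=.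
have := @filter_forall _ _ (fun i y => 0 < E i y) (nbhs z) _; apply=> i.
apply: (@open_nbhs_nbhs _ z [set y | 0 < E i y]); split; last exact: Ez.
exact: affine_open (Ea i).
Qed.

(** If [f] vanished at [z], then moving from [z] a little away from [w] would
    make [f] negative while staying in [K]. *)
Lemma affine_interior_gt0 f K w z : affine f -> (forall y, K y -> 0 <= f y) ->
  0 < f w -> interior K z -> 0 < f z.
Proof.
move=> fa fK fw zi; rewrite lt_neqAle fK ?andbT; last exact: interior_subset.
rewrite eq_sym; apply/eqP => fz.
pose h (s : R) : pt := z + s *: (z - w).
have hc : continuous h.
  move=> s; apply: cvgD; first exact: cvg_cst.
  by apply: cvgZr_tmp; exact: cvg_id.
have : nbhs (0 : R) (h @^-1` interior K).
  apply: hc; rewrite /h scale0r addr0.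
  by apply: open_nbhs_nbhs; split=> //; exact: open_interior.
move=> [r /= r0 hr].
have := hr (r / 2); rewrite /= sub0r normrN gtr0_norm ?divr_gt0//.
move=> H; have {}H := fK _ (interior_subset (H ltac:(lra))).
move: H; have [a [b [c fE]]] := fa.
have -> : f (h (r / 2)) = f z + r / 2 * (f z - f w).
  by rewrite !fE /= /GRing.scale /=; ring.
rewrite fz; nra.
Qed.

(** * Convex polygons given by corners and edge functions *)

Section Polygon.
Variables (k : nat) (e : 'I_k -> pt -> R) (v : 'I_k -> pt).

(** A strictly convex polygon, given at once by its corners [v i] in cyclic
    order and by an affine function [e i] for the edge from [v i] to the next
    corner.  Corners give convex hulls, edge functions give sign tests. *)
Record polygon : Prop := Polygon {
  polygon_size : (2 < k)%N;
  polygon_affine : forall i, affine (e i);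
  polygon_start : forall i, e i (v i) = 0;
  polygon_end : forall i, e i (v (ordS i)) = 0;
  polygon_pos : forall i j, j != i -> j != ordS i -> 0 < e i (v j) }.

Hypothesis P : polygon.

Lemma ordS_neq (i : 'I_k) : ordS i != i.
Proof.
have k2 := polygon_size P; have ik := ltn_ord i.
apply/eqP => /(congr1 val) /=; have [h|h] := ltnP i.+1 k.
  by rewrite modn_small//; lia.
have -> : i.+1 = k by lia.
by rewrite modnn; lia.
Qed.

Lemma ordSS_neq (i : 'I_k) : ordS (ordS i) != i.
Proof.
have k2 := polygon_size P; have ik := ltn_ord i.
apply/eqP => /(congr1 val) /=; have [h|h] := ltnP i.+1 k.
  rewrite (modn_small h); have [h'|h'] := ltnP i.+2 k.
    by rewrite modn_small//; lia.
  have -> : i.+2 = k by lia.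
  by rewrite modnn; lia.
have -> : i.+1 = k by lia.
by rewrite modnn modn_small; lia.
Qed.

Lemma polygon_ge0 i j : 0 <= e i (v j).
Proof.
have [->|ji] := eqVneq j i; first by rewrite polygon_start.
have [->|jS] := eqVneq j (ordS i); first by rewrite polygon_end.
exact/ltW/polygon_pos.
Qed.

(** The edge functions of the two neighbouring edges keep a point of the line
    of an edge between the two ends of that edge. *)
Lemma polygon_edge i z :
  (forall j, 0 <= e j z) -> e i z = 0 -> segment (v i) (v (ordS i)) z.
Proof.
move=> ez eiz.
have next_pos : 0 < e (ordS i) (v i).
  by apply: polygon_pos => //; rewrite eq_sym ?ordS_neq ?ordSS_neq.
have prev_pos : 0 < e (ord_pred i) (v (ordS i)).
  apply: polygon_pos => //; last by rewrite ord_predK ordS_neq.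
  by rewrite -[X in ordS X != _]ord_predK ordSS_neq.
have [||||||t zE] := @affine_zero_line (e i) (v i) (v (ordS i)) (v (ordS (ordS i))) z.
- exact: polygon_affine.
- by apply: contraTneq next_pos => ->; rewrite polygon_start // ltxx.
- exact: polygon_start.
- exact: polygon_end.
- by rewrite gt_eqF// polygon_pos// ?ordSS_neq ?ordS_neq.
- by [].
exists t => //=.
have := ez (ord_pred i); rewrite zE affineP; last exact: polygon_affine.
have -> : e (ord_pred i) (v i) = 0.
  by rewrite -[i in v i]ord_predK polygon_end.
have := ez (ordS i); rewrite zE affineP; last exact: polygon_affine.
rewrite polygon_start// => h1 h2.
by apply/andP; split; nra.
Qed.

(** A ray that makes some edge function decrease leaves the polygon; the exit
    time is the least of the times at which a decreasing edge function
    vanishes. *)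
Lemma polygon_exit z d i0 : (forall i, 0 < e i z) -> e i0 (z + d) < e i0 z ->
  exists t i, [/\ 0 < t, forall j, 0 <= e j (z + t *: d) & e i (z + t *: d) = 0].
Proof.
move=> ez i0d; pose g i := e i (z + d) - e i z.
have gi0 : g i0 < 0 by rewrite subr_lt0.
case: (@arg_minP _ _ _ i0 (fun i => g i < 0) (fun i => e i z / - g i) gi0) => i gi imin.
have ti : 0 < e i z / - g i by rewrite divr_gt0 ?oppr_gt0.
exists (e i z / - g i), i; split=> // [j|]; rewrite affine_ray;
  try exact: polygon_affine.
  have [gj|gj] := ltP (g j) 0; last first.
    exact: (addr_ge0 (ltW (ez j)) (mulr_ge0 (ltW ti) gj)).
  have := imin j gj; rewrite ler_pdivlMr ?oppr_gt0// -/(g j); lra.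
by rewrite -/(g i); field; rewrite lt_eqF.
Qed.

(** The parallel through [z] to an edge leaves the polygon at two points of
    its edges, and [z] lies between them. *)
Lemma polygon_sub z : (forall i, 0 <= e i z) -> conv_hull (range v) z.
Proof.
move=> ez; have vh i : conv_hull (range v) (v i) by apply: sub_conv_hull; exists i.
have onedge y i : (forall j, 0 <= e j y) -> e i y = 0 -> conv_hull (range v) y.
  move=> ey eiy; apply: cvx_segment (polygon_edge ey eiy) => //.
  exact: cvx_conv_hull.
have [[i eiz]|ne0] := pselect (exists i, e i z = 0); first exact: onedge eiz.
have {}ez i : 0 < e i z.
  by rewrite lt_neqAle ez andbT eq_sym; apply/eqP => eiz; apply: ne0; exists i.
have k0 : (0 < k)%N by apply: leq_trans (polygon_size P).
pose i := Ordinal k0; pose d := v i - v (ordS i).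
have eE j s : e j (z + s *: d) = e j z + s * (e j (v i) - e j (v (ordS i))).
  have [a [b [c fE]]] := polygon_affine P j.
  by rewrite !fE /= /GRing.scale /=; ring.
have next_pos : 0 < e (ordS i) (v i).
  by apply: polygon_pos => //; rewrite eq_sym ?ordS_neq ?ordSS_neq.
have prev_pos : 0 < e (ord_pred i) (v (ordS i)).
  apply: polygon_pos => //; last by rewrite ord_predK ordS_neq.
  by rewrite -[X in ordS X != _]ord_predK ordSS_neq.
have prev0 : e (ord_pred i) (v i) = 0.
  by rewrite -[i in v i]ord_predK polygon_end.
have [|t1 [i1 [t10 e1 e10]]] := @polygon_exit z d (ord_pred i) ez.
  by rewrite -[d]scale1r eE prev0; lra.
have [|t2 [i2 [t20 e2 e20]]] := @polygon_exit z (- d) (ordS i) ez.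
  by rewrite -scaleN1r eE polygon_start//; lra.
have h1 := onedge _ _ e1 e10; have h2 := onedge _ _ e2 e20.
have -> : z = (1 - t2 / (t1 + t2)) *: (z + t2 *: - d) + (t2 / (t1 + t2)) *: (z + t1 *: d).
  case: (z) (d) => [z1 z2] [d1 d2].
  by congr pair; rewrite /= /GRing.scale /=; field; rewrite gt_eqF// addr_gt0.
apply: cvx_conv_hull => //; rewrite divr_ge0 ?ler_pdivrMr; lra.
Qed.

Lemma polygon_hullE : conv_hull (range v) = [set z | forall i, 0 <= e i z].
Proof.
apply/seteqP; split=> [z hz i|z]; last exact: polygon_sub.
have := @conv_hull_sub (range v) [set z | 0 <= e i z]; apply=> //.
  exact/affine_cvx_ge/polygon_affine.
by move=> _ [j _ <-]; exact: polygon_ge0.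
Qed.

(** The sum of the two edge functions that vanish at a corner is positive at
    all the other corners. *)
Lemma polygon_extreme i : ~ conv_hull (v @` [set j | j != i]) (v i).
Proof.
pose f z := e i z + e (ord_pred i) z.
have fa : affine f by apply: affineD; exact: polygon_affine.
have sub : v @` [set j | j != i] `<=` [set z | 0 < f z].
  move=> _ [j /= ji <-]; rewrite /f.
  have [->|jS] := eqVneq j (ordS i).
    rewrite polygon_end// add0r polygon_pos//; last by rewrite ord_predK ordS_neq.
    by rewrite -[X in ordS X != _]ord_predK ordSS_neq.
  by rewrite ltr_wpDr ?polygon_ge0 ?polygon_pos.
move=> /(conv_hull_sub (affine_cvx_gt fa) sub) /=.
by rewrite /f polygon_start// -[i in v i]ord_predK polygon_end// addr0 ltxx.
Qed.

Lemma polygon_interior :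
  interior (conv_hull (range v)) = [set z | forall i, 0 < e i z].
Proof.
apply/seteqP; split=> z; last first.
  move=> ez; rewrite /interior polygon_hullE.
  have eo := finite_open (polygon_affine P).
  by apply: filterS (open_nbhs_nbhs (conj eo ez)) => y ey i; exact/ltW.
move=> zi i; have pos : 0 < e i (v (ordS (ordS i))).
  by rewrite polygon_pos ?ordSS_neq ?ordS_neq.
apply: affine_interior_gt0 (polygon_affine P i) _ pos zi.
by rewrite polygon_hullE => y.
Qed.

End Polygon.

(** * Convex hulls of finite sets *)

Definition join x A := [set (1 - p.1) *: x + p.1 *: p.2 | p in `[0, 1] `*` A].

Lemma cvx_join x A : cvx A -> cvx (join x A).
Proof.
move=> cA _ _ s s01 [[t y] [/= t01 Ay] <-] [[u z] [/= u01 Az] <-].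
move: t01 u01 s01; rewrite !in_itv /= => /andP[t0 t1] /andP[u0 u1] /andP[s0 s1].
pose r := (1 - s) * t + s * u.
have r0 : 0 <= r by rewrite /r; nra.
have r1 : r <= 1 by rewrite /r; nra.
have [r00|r00] := eqVneq r 0.
  exists (0, y); first by split=> //=; rewrite in_itv /= lexx ler01.
  have st : (1 - s) * t = 0 by rewrite /r in r00; nra.
  have su : s * u = 0 by rewrite /r in r00; nra.
  case: (x) (y) (z) => [x1 x2] [y1 y2] [z1 z2]; congr pair; rewrite /= /GRing.scale /=.
    transitivity (x1 - ((1 - s) * t) * (x1 - y1) - (s * u) * (x1 - z1)); last by ring.
    by rewrite st su; ring.
  transitivity (x2 - ((1 - s) * t) * (x2 - y2) - (s * u) * (x2 - z2)); last by ring.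
  by rewrite st su; ring.
have rp : 0 < r by rewrite lt_neqAle eq_sym r00.
exists (r, (1 - s * u / r) *: y + (s * u / r) *: z); last first.
  case: (x) (y) (z) => [x1 x2] [y1 y2] [z1 z2].
  by congr pair; rewrite /= /GRing.scale /=; rewrite /r; field.
split; rewrite /= ?in_itv /= ?r0 ?r1//; apply: cA => //.
by rewrite divr_ge0 ?ler_pdivrMr ?mulr_ge0//= mul1r /r; nra.
Qed.

Lemma conv_hull_join x A : A !=set0 -> conv_hull (x |` A) `<=` join x (conv_hull A).
Proof.
move=> [a Aa]; apply: conv_hull_sub; first exact: cvx_join (@cvx_conv_hull A).
move=> y [/= ->|Ay].
  exists (0, a); last by rewrite /= subr0 scale1r scale0r addr0.
  by split; rewrite /= ?in_itv/= ?lexx ?ler01//; exact: sub_conv_hull.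
exists (1, y); last by rewrite /= subrr scale1r scale0r add0r.
by split; rewrite /= ?in_itv/= ?lexx ?ler01//; exact: sub_conv_hull.
Qed.

Lemma compact_join x K : compact K -> compact (join x K).
Proof.
move=> cK; apply: continuous_compact; last first.
  by apply: compact_setX => //; exact: segment_compact.
apply: continuous_subspaceT => -[t y]; apply: cvgD.
  apply: cvgZr_tmp; apply: cvgB; first exact: cvg_cst.
  exact: cvg_fst.
by apply: cvgZ; [exact: cvg_fst|exact: cvg_snd].
Qed.

Lemma conv_hull_insert x A : A !=set0 ->
  conv_hull (x |` A) = join x (conv_hull A).
Proof.
move=> A0; apply/seteqP; split; first exact: conv_hull_join.
move=> _ [[t y] [/= t01 Ay] <-]; move: t01; rewrite in_itv /= => t01.
apply: cvx_conv_hull => //; first by apply: sub_conv_hull; left.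
apply: conv_hull_sub Ay; first exact: cvx_conv_hull.
by move=> z Az; apply: sub_conv_hull; right.
Qed.

Lemma cvx1 x : cvx [set x].
Proof.
move=> _ _ t _ -> ->; rewrite -scalerDl subrK scale1r //.
Qed.

(** The hull with a new point [x] added is a continuous image of the product of
    [[0, 1]] and the old hull. *)
Lemma compact_conv_hull (s : seq pt) : compact (conv_hull [set` s]).
Proof.
elim: s => [|x [|y s] IH].
- have -> : conv_hull [set` [::]] = set0 :> set pt; last exact: compact0.
  by apply/seteqP; split=> //; apply: conv_hull_sub => // ? ? ? _ [].
- have -> : conv_hull [set` [:: x]] = [set x]; last exact: compact_set1.
  apply/seteqP; split=> [|_ ->]; last by apply: sub_conv_hull; rewrite /= mem_head.
  apply: conv_hull_sub; first exact: cvx1.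
  by move=> z /=; rewrite inE => /eqP.
have -> : [set` x :: y :: s] = x |` [set` y :: s].
  by apply/seteqP; split=> z /=; rewrite (in_cons x) => /predU1P.
rewrite conv_hull_insert; first exact: compact_join.
by exists y; rewrite /= mem_head.
Qed.

Lemma compact_conv_hull_range (k : nat) (v : 'I_k -> pt) :
  compact (conv_hull (range v)).
Proof.
have -> : range v = [set` codom v]; last exact: compact_conv_hull.
apply/seteqP; split=> z /=; first by move=> [i _ <-]; exact: codom_f.
by move=> /codomP[i ->]; exists i.
Qed.

(** Removing the extreme point [v i] from the hull leaves a convex set, so a
    set of points of the hull that avoids [v i] cannot generate it. *)
Lemma conv_hull_extreme (I : eqType) (v : I -> pt) (i : I) (A : set pt) :
  ~ conv_hull (v @` [set j | j != i]) (v i) ->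
  A `<=` conv_hull (range v) -> conv_hull A (v i) -> A (v i).
Proof.
set B := v @` _ => Bvi AV Avi.
have [[b Bb]|B0] := pselect (B !=set0); last first.
  have : conv_hull (range v) `<=` [set v i].
    apply: conv_hull_sub; first exact: cvx1.
    move=> _ [j _ <-]; have [->//|ji] := eqVneq j i.
    by exfalso; apply: B0; exists (v j); exists j.
  move=> sub; have [[a Aa]|A0] := pselect (A !=set0).
    by have := sub _ (AV _ Aa) => /= <-.
  have : conv_hull A `<=` set0 by apply: conv_hull_sub => [? ? ? _ []|a Aa]; case: A0; exists a.
  by move=> /(_ _ Avi).
have Vsub : conv_hull (range v) `<=` join (v i) (conv_hull B).
  move=> z Vz; apply: (conv_hull_join (ex_intro _ b Bb)); move: z Vz.
  apply: conv_hull_sub; first exact: cvx_conv_hull.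
  move=> _ [j _ <-]; apply: sub_conv_hull.
  by have [->|ji] := eqVneq j i; [left|right; exists j].
apply: contrapT => Ai.
pose M := [set (1 - p.1) *: v i + p.1 *: p.2 | p in `]0, 1] `*` conv_hull B].
have cM : cvx M.
  move=> _ _ s s01 [[t y] [/= t01 Ay] <-] [[u z] [/= u01 Az] <-].
  move: t01 u01 s01; rewrite !in_itv /= => /andP[t0 t1] /andP[u0 u1] /andP[s0 s1].
  pose r := (1 - s) * t + s * u.
  have rp : 0 < r by rewrite /r; nra.
  have r1 : r <= 1 by rewrite /r; nra.
  exists (r, (1 - s * u / r) *: y + (s * u / r) *: z); last first.
    case: (v i) (y) (z) => [x1 x2] [y1 y2] [z1 z2].
    by congr pair; rewrite /= /GRing.scale /=; rewrite /r; field; rewrite gt_eqF.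
  split; rewrite /= ?in_itv /= ?rp ?r1//; apply: cvx_conv_hull => //.
  by rewrite divr_ge0 ?ler_pdivrMr ?mulr_ge0 ?(ltW rp) ?(ltW u0)//= mul1r /r; nra.
have AM : A `<=` M.
  move=> a Aa; have [[t y] [/= t01 By] ay] := Vsub _ (AV _ Aa).
  exists (t, y) => //; split=> //=; move: t01; rewrite !in_itv /= => /andP[t0 ->].
  rewrite andbT lt_neqAle t0 andbT eq_sym; apply/eqP => t00; apply: Ai.
  by move: ay; rewrite t00 subr0 scale1r scale0r addr0 => ->.
have [[t y] [/=]] := conv_hull_sub cM AM Avi.
rewrite in_itv /= => /andP[t0 t1] By yE; apply: Bvi.
suff -> : v i = y by [].
have : t *: (y - v i) = 0.
  rewrite -[RHS](subrr (v i)) -[X in _ = X - _]yE scalerBr scalerBl scale1r.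
  by rewrite addrAC [v i - _ - _]addrAC subrr add0r addrC.
by move/eqP; rewrite scaler_eq0 gt_eqF//= subr_eq0 => /eqP.
Qed.

Lemma segment_connected2 x y : connected (segment x y).
Proof.
apply: connected_continuous_connected; last first.
  apply: continuous_subspaceT => t; apply: cvgD.
    apply: cvgZr_tmp; apply: cvgB; first exact: cvg_cst.
    exact: cvg_id.
  by apply: cvgZr_tmp; exact: cvg_id.
have -> : [set t : R | 0 <= t <= 1] = `[0, 1]%classic.
  by apply/seteqP; split=> t /=; rewrite in_itv.
exact: segment_connected.
Qed.

Lemma cvx_connected A : cvx A -> connected A.
Proof.
move=> cA; have [[x Ax]|A0] := pselect (A !=set0); last first.
  have -> : A = set0 by apply/seteqP; split=> // z Az; case: A0; exists z.
  exact: connected0.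
have -> : A = \bigcup_(y in A) segment x y.
  apply/seteqP; split=> [y Ay|z [y Ay]]; last exact: cvx_segment.
  exists y => //; exists 1; first by rewrite /= ler01 lexx.
  by rewrite subrr scale0r add0r scale1r.
apply: bigcup_connected => [|y _]; last exact: segment_connected2.
exists x => y _; exists 0; first by rewrite /= ler01 lexx.
by rewrite subr0 scale0r addr0 scale1r.
Qed.

(** A homothety centred at [z] maps a neighbourhood of [q] contained in [K] to
    a neighbourhood, contained in [K], of a point as close to [z] as wanted. *)
Lemma cvx_interior_dense K q : cvx K -> interior K q -> K `<=` closure (interior K).
Proof.
move=> cK Kq z Kz.
pose y (s : R) := (1 - s) *: z + s *: q.
have yK s : 0 < s -> s <= 1 -> interior K (y s).
  move=> s0 s1.
  pose h (x : pt) := s^-1 *: (x - (1 - s) *: z).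
  have hc : continuous h.
    move=> x; apply: cvgZl_tmp; apply: cvgB; first exact: cvg_id.
    exact: cvg_cst.
  have hy : h (y s) = q by rewrite /h /y addrC addKr scalerA mulVf ?scale1r ?gt_eqF.
  have : nbhs (y s) (h @^-1` K) by apply: hc; rewrite hy.
  apply: filterS => x Kx; have -> : x = (1 - s) *: z + s *: h x.
    by rewrite /h scalerA divff ?gt_eqF// scale1r addrC subrK.
  by apply: cK => //; rewrite s1 ltW.
have yc : continuous y.
  move=> s; apply: cvgD; last by apply: cvgZr_tmp; exact: cvg_id.
  by apply: cvgZr_tmp; apply: cvgB; [exact: cvg_cst|exact: cvg_id].
move=> B zB; have : nbhs (0 : R) (y @^-1` B).
  by apply: yc; rewrite /y subr0 scale1r scale0r addr0.
move=> [r /= r0 hr]; pose s := Num.min (r / 2) 1.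
have s0 : 0 < s by rewrite /s lt_min divr_gt0 ?ltr01.
have s1 : s <= 1 by rewrite /s ge_min lexx orbT.
exists (y s); split; first exact: yK.
apply: hr; rewrite /= sub0r normrN gtr0_norm//.
by rewrite /s gt_min; apply/orP; left; lra.
Qed.

Lemma conv_hull_closed (k : nat) (v : 'I_k -> pt) : closed (conv_hull (range v)).
Proof.
apply: compact_closed; last exact: compact_conv_hull_range.
exact: norm_hausdorff.
Qed.

Lemma conv_hull_interior_sub (k m : nat) (v : 'I_k -> pt) (w : 'I_m -> pt) :
  interior (conv_hull (range v)) !=set0 ->
  interior (conv_hull (range v)) `<=` conv_hull (range w) ->
  conv_hull (range v) `<=` conv_hull (range w).
Proof.
move=> [q qv] vw z vz; apply: (conv_hull_closed (v := w)).
exact: closureS vw _ (cvx_interior_dense (@cvx_conv_hull _) qv vz).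
Qed.

(** Two hulls with the same nonempty interior are equal, being its closure, and
    every corner of [v], being extreme, has to be one of the points [w]. *)
Lemma convex_polygon_size (k m : nat) (v : 'I_k -> pt) (w : 'I_m -> pt) (V : set pt) :
  convex_polygon v V -> interior V !=set0 ->
  interior V = interior (conv_hull (range w)) -> (k <= m)%N.
Proof.
move=> [vext ->] V0 VW.
have vw : conv_hull (range v) `<=` conv_hull (range w).
  by apply: conv_hull_interior_sub => //; rewrite VW; exact: interior_subset.
have wv : conv_hull (range w) `<=` conv_hull (range v).
  by apply: conv_hull_interior_sub; rewrite -VW //; exact: interior_subset.
have vin i : exists j, w j = v i.
  have [||j _ <-] := @conv_hull_extreme _ v i (range w) (vext i); last by exists j.
    by move=> z wz; apply: wv; exact: sub_conv_hull.
  by apply: vw; apply: sub_conv_hull; exists i.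
have [g gE] := choice vin.
have vinj : injective v.
  move=> i j vij; apply/eqP/negPn/negP => ij; apply: (vext i).
  by rewrite vij; apply: sub_conv_hull; exists j => //=; rewrite eq_sym.
have ginj : injective g by move=> i j gij; apply: vinj; rewrite -!gE gij.
by have := leq_card g ginj; rewrite !card_ord.
Qed.

(** * Faces of a drawing *)

Section PolygonFace.
Variables (k : nat) (e : 'I_k -> pt -> R) (v : 'I_k -> pt).
Hypothesis P : polygon e v.

Lemma polygon_interior_point : exists q, forall i, 0 < e i q.
Proof.
have k0 : (0 < k)%N by apply: leq_trans (polygon_size P).
pose a := Ordinal k0; pose b := ordS a; pose c := ordS b.
have ab : b != a by apply: ordS_neq P _.
have bc : c != b by apply: ordS_neq P _.
have ac : c != a by apply: ordSS_neq P _.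
exists ((1 - 3^-1) *: ((1 - 2^-1) *: v a + 2^-1 *: v b) + 3^-1 *: v c) => i.
rewrite !affineP; do ?exact: polygon_affine P _.
suff : [|| 0 < e i (v a), 0 < e i (v b) | 0 < e i (v c)].
  have := polygon_ge0 P i a; have := polygon_ge0 P i b; have := polygon_ge0 P i c.
  by move=> h1 h2 h3 /or3P[]; lra.
apply/negPn/negP; rewrite !negb_or => /and3P[na nb nc].
have nz (x : 'I_k) : ~~ (0 < e i (v x)) -> (x == i) || (x == ordS i).
  by apply: contraNT; rewrite negb_or => /andP[]; exact: (polygon_pos P).
move: (nz _ na) (nz _ nb) (nz _ nc) ab bc ac.
by move=> /orP[]/eqP-> /orP[]/eqP-> /orP[]/eqP->; rewrite ?eqxx.
Qed.

(** The boundary of the polygon belongs to [D], so the open polygon is both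
    open and closed in any connected set that avoids [D]. *)
Lemma polygon_component (D : set pt) q :
  (forall i, segment (v i) (v (ordS i)) `<=` D) ->
  (forall z, D z -> exists i, e i z <= 0) -> (forall i, 0 < e i q) ->
  connected_component (~` D) q = [set z | forall i, 0 < e i z].
Proof.
move=> vD De eq; set G := [set z | _].
have GD : G `<=` ~` D by move=> z Gz /De[i]; rewrite leNgt Gz.
apply/seteqP; split; last first.
  apply: connected_component_max => //; apply: cvx_connected => x y t t01 Gx Gy i.
  by apply: affine_cvx_gt (polygon_affine P i) _ _ _ t01 (Gx i) (Gy i).
move=> z [C [Cq CD Cc] Cz].
suff CG : C `&` G = C by move: Cz; rewrite -CG => -[].
apply: Cc.
- by exists q.
- by exists G => //; exact: finite_open (polygon_affine P).
exists (conv_hull (range v)); first exact: conv_hull_closed.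
rewrite (polygon_hullE P); apply/seteqP; split=> y [Cy Gy]; split=> // i.
  exact/ltW.
rewrite lt_neqAle Gy andbT; apply/eqP => eiy; apply: (CD _ Cy).
by apply: (vD i); apply: polygon_edge P _ _ Gy (esym eiy).
Qed.

Lemma polygon_k_face (D : set pt) :
  (forall i, segment (v i) (v (ordS i)) `<=` D) ->
  (forall z, D z -> exists i, e i z <= 0) ->
  k_face k D (interior (conv_hull (range v))).
Proof.
move=> vD De; have [q eq] := polygon_interior_point; split.
- exists q; last by rewrite (polygon_component vD De eq) (polygon_interior P).
  by move=> /De[i]; rewrite leNgt eq.
- have [M [Mr HM]] := compact_bounded (compact_conv_hull_range (v := v)).
  by exists M; split=> // x Mx y /interior_subset; exact: HM.
- exists v, (conv_hull (range v)); split=> //; split=> //.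
  exact: polygon_extreme P.
Qed.

End PolygonFace.

(** The whole open half-plane [f < 0] lies in the component of [q]; [w] makes
    sure that [f] is not constant. *)
Lemma unbounded_component (D : set pt) f q w : affine f ->
  (forall z, D z -> 0 <= f z) -> f q < 0 -> 0 <= f w ->
  ~ bounded_set (connected_component (~` D) q).
Proof.
move=> fa fD fq fw [M [Mr HM]].
have sub : [set z | 0 < - f z] `<=` connected_component (~` D) q.
  apply: connected_component_max; first by rewrite /= oppr_gt0.
    by move=> z /= fz /fD; lra.
  exact/cvx_connected/affine_cvx_gt/affineN.
have qw : 0 < `|q - w|.
  by rewrite normr_gt0 subr_eq0; apply: contraTneq fq => ->; rewrite -leNgt.
(* the ray from [w] through [q], followed until its norm exceeds [M] *)
pose N := `|M| + 2 + `|q|.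
have N0 : 0 <= N / `|q - w| by rewrite divr_ge0// /N !addr_ge0.
have := HM (`|M| + 1) _ (q + (N / `|q - w|) *: (q - w)).
have -> : M < `|M| + 1 by rewrite (le_lt_trans (ler_norm M))// ltrDl.
move=> /(_ isT) H; have {}H := H (sub _ _).
have : `|q + (N / `|q - w|) *: (q - w)| <= `|M| + 1.
  apply: H; rewrite /=; have [a [b [c fE]]] := fa.
  have -> : f (q + (N / `|q - w|) *: (q - w)) = f q + N / `|q - w| * (f q - f w).
    by rewrite !fE /= /GRing.scale /=; ring.
  have h : (N / `|q - w|) * (f q - f w) <= 0 by rewrite mulr_ge0_le0//; lra.
  lra.
apply/negP; rewrite -ltNge.
have : `|(N / `|q - w|) *: (q - w)| = N.
  rewrite normrZ ger0_norm// divfK// gt_eqF//.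
have := ler_normB (q + (N / `|q - w|) *: (q - w)) q.
by rewrite [q + _]addrC addrK => h1 h2; rewrite h2 /N in h1; lra.
Qed.

(** In this section [D] is covered by the lines [l i = 0] while the face [F]
    avoids these lines altogether, as a bounded face of a drawing of the
    complete graph on the corners of a convex polygon does. *)
Section Arrangement.
Variables (I : Type) (l : I -> pt -> R) (D F : set pt) (q : pt).
Hypothesis la : forall i, affine (l i).
Hypothesis Dl : forall z, D z -> exists i, l i z = 0.
Hypothesis FE : F = connected_component (~` D) q.
Hypothesis Fl : forall z i, F z -> l i z != 0.
Hypothesis Dq : ~ D q.

(** The functions [l i] keep their signs on the connected set [F]; conversely
    the points with given signs form a convex set that avoids [D]. *)
Lemma arrangement_face : F = [set z | forall i, 0 < l i q * l i z].
Proof.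
have Fq : F q by rewrite FE; exact: connected_component_refl.
have Fc : connected F by rewrite FE; exact: component_connected.
have sq i : affine (fun z => l i q * l i z).
  have [a [b [c fE]]] := la i.
  by exists (l i q * a), (l i q * b), (l i q * c) => z; rewrite !fE; ring.
apply/seteqP; split=> [z Fz i|]; last first.
  rewrite FE; apply: connected_component_max.
  - by move=> i /=; rewrite -expr2 exprn_even_gt0 ?Fl.
  - by move=> z lz /Dl[i li]; have := lz i; rewrite li mulr0 ltxx.
  apply: cvx_connected => x y t t01 Gx Gy i.
  by apply: affine_cvx_gt (sq i) _ _ _ t01 (Gx i) (Gy i).
suff FG : F `&` [set z | 0 < l i q * l i z] = F by move: Fz; rewrite -FG => -[].
apply: Fc.
- by exists q; split=> //=; rewrite -expr2 exprn_even_gt0 ?Fl.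
- by exists [set z | 0 < l i q * l i z] => //; exact: affine_open.
exists (~` [set z | 0 < - (l i q * l i z)]).
  by apply: open_closedC; apply: affine_open; exact: affineN.
apply/seteqP; split=> y [Fy /= ly]; split=> //=; first lra.
by rewrite lt_neqAle eq_sym mulf_neq0 ?Fl//=; rewrite leNgt -oppr_gt0; exact/negP.
Qed.

(** As no line separates the corners of the polygon, all its interior points
    have the same signs as [q], so it is the entire cell of [q]. *)
Lemma arrangement_polygon (m : nat) (e : 'I_m -> pt -> R) (w : 'I_m -> pt) :
  polygon e w -> (forall i, 0 < e i q) ->
  (forall i, exists j, e i = l j \/ e i = (fun z => - l j z)) ->
  (forall j, (forall i, 0 <= l j (w i)) \/ (forall i, l j (w i) <= 0)) ->
  F = interior (conv_hull (range w)).
Proof.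
move=> P eq el lw; rewrite arrangement_face (polygon_interior P).
have Fq : F q by rewrite FE; exact: connected_component_refl.
apply/seteqP; split=> z lz i.
  have [j [ej|ej]] := el i; have := lz j; have := eq i; rewrite ej; nra.
have zi : interior (conv_hull (range w)) z by rewrite (polygon_interior P).
have qi : conv_hull (range w) q.
  by apply: interior_subset; rewrite (polygon_interior P).
have pos f : affine f -> (forall j, 0 <= f (w j)) -> f q != 0 -> 0 < f q /\ 0 < f z.
  move=> fa fw fq; have fh : forall y, conv_hull (range w) y -> 0 <= f y.
    move=> y; apply: (conv_hull_sub (affine_cvx_ge fa)) => _ [j _ <-]; exact: fw.
  have fq0 : 0 < f q by rewrite lt_neqAle eq_sym fq fh.
  by split=> //; exact: affine_interior_gt0 fa fh fq0 zi.
have [lw0|lw0] := lw i.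
  by have [h1 h2] := pos (l i) (la i) lw0 (Fl i Fq); exact: mulr_gt0.
have [|||h1 h2] := pos (fun z => - l i z); last by nra.
- exact: affineN.
- by move=> j; rewrite oppr_ge0.
- by rewrite oppr_eq0 Fl.
Qed.

End Arrangement.
End Plane.

(** * Chords of a regular polygon *)
Section RegularPolygon.
Variables (R : realType) (n : nat) (c : R * R) (r theta : R).
Hypotheses (n_ge3 : (2 < n)%N) (r_gt0 : 0 < r).
Local Notation pt := (R * R)%type.
Implicit Types (z : pt) (a b u v x : R).

Local Notation N := (n%:R : R).

(** Trigonometric functions with the unit of angle [pi / n], which is the angle
    under which a vertex sees a side. *)
Definition sine x : R := sin (x * (pi / N)).
Local Notation s := sine.
Definition cosine x : R := cos (x * (pi / N)).
Local Notation co := cosine.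
(** Indices are real numbers, so that index computations are ring identities;
    the vertices are the points of integral index. *)
Definition ngon x : pt :=
  (c.1 + r * cos (theta + 2 * x * (pi / N)), c.2 + r * sin (theta + 2 * x * (pi / N))).
Local Notation P := ngon.
(** [abscissa] and [ordinate] are the coordinates in which the polygon is
    inscribed in the unit circle with vertex 0 at angle 0. *)
Definition abscissa z := ((z.1 - c.1) * cos theta + (z.2 - c.2) * sin theta) / r.
Local Notation X := abscissa.
Definition ordinate z := ((z.2 - c.2) * cos theta - (z.1 - c.1) * sin theta) / r.
Local Notation Y := ordinate.
(** The line through the points of index [a] and [b] is normal to the direction
    of angle [a + b] and at distance [cosine (b - a)] from the centre.  The
    factor 1/2 makes [chord_ngon] a plain product of sines. *)
Definition chord a b z :=
  (co (b - a) - X z * co (a + b) - Y z * s (a + b)) / 2.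

Let N_gt0 : 0 < N. Proof. by rewrite ltr0n; apply: leq_trans n_ge3. Qed.
Let N_ge3 : 3 <= N. Proof. by rewrite ler_nat. Qed.

Lemma abscissa_vertex x : X (P x) = co (2 * x).
Proof.
rewrite /abscissa /ngon /cosine /= cosD sinD; set C := cos (_ * _); set S := sin (_ * _).
transitivity (C * (cos theta ^+ 2 + sin theta ^+ 2)); last by rewrite cos2Dsin2 mulr1.
by field; rewrite gt_eqF.
Qed.

Lemma ordinate_vertex x : Y (P x) = s (2 * x).
Proof.
rewrite /ordinate /ngon /sine /= cosD sinD; set C := cos (_ * _); set S := sin (_ * _).
transitivity (S * (cos theta ^+ 2 + sin theta ^+ 2)); last by rewrite cos2Dsin2 mulr1.
by field; rewrite gt_eqF.
Qed.

Lemma chord_affine a b : affine (chord a b).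
Proof.
exists (- (co (a + b) * cos theta - s (a + b) * sin theta) / r / 2).
exists (- (co (a + b) * sin theta + s (a + b) * cos theta) / r / 2).
exists ((co (b - a) - co (a + b) * (- c.1 * cos theta - c.2 * sin theta) / r
  - s (a + b) * (- c.2 * cos theta + c.1 * sin theta) / r) / 2) => z.
by rewrite /chord /abscissa /ordinate; field; rewrite gt_eqF.
Qed.

Lemma sineN x : s (- x) = - s x. Proof. by rewrite /sine mulNr sinN. Qed.
Lemma cosineN x : co (- x) = co x. Proof. by rewrite /cosine mulNr cosN. Qed.
Lemma sine0 : s 0 = 0. Proof. by rewrite /sine mul0r sin0. Qed.
Lemma sineD x u : s (x + u) = s x * co u + co x * s u.
Proof. by rewrite /sine mulrDl sinD. Qed.
Lemma sineB x u : s (x - u) = s x * co u - co x * s u.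
Proof. by rewrite /sine mulrBl sinB. Qed.
Lemma cosineD x u : co (x + u) = co x * co u - s x * s u.
Proof. by rewrite /cosine mulrDl cosD. Qed.
Lemma cosineB x u : co (x - u) = co x * co u + s x * s u.
Proof. by rewrite /cosine mulrBl cosB. Qed.
Lemma cosine2_sine2 x : co x ^+ 2 = 1 - s x ^+ 2.
Proof. by rewrite /cosine /sine cos2sin2. Qed.
Lemma sine_n : s N = 0.
Proof. by rewrite /sine mulrC divfK ?sinpi// gt_eqF. Qed.
Lemma cosine_n : co N = -1.
Proof. by rewrite /cosine mulrC divfK ?cospi// gt_eqF. Qed.
Lemma sineDn x : s (x + N) = - s x.
Proof. by rewrite sineD sine_n cosine_n; ring. Qed.
Lemma sine_nB x : s (N - x) = s x.
Proof. by rewrite sineB sine_n cosine_n; ring. Qed.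

Lemma sine_gt0 x : 0 < x < N -> 0 < s x.
Proof.
move=> /andP[x0 xN]; apply: sin_gt0_pi.
by rewrite mulr_gt0 ?divr_gt0 ?pi_gt0//= mulrA ltr_pdivrMr// mulrC ltr_pM2l ?pi_gt0.
Qed.

Lemma sine_ge0 x : 0 <= x <= N -> 0 <= s x.
Proof.
move=> /andP[x0 xN]; apply: sin_ge0_pi.
by rewrite mulr_ge0 ?divr_ge0 ?pi_ge0 ?(ltW N_gt0)//= mulrA ler_pdivrMr// mulrC ler_pM2l ?pi_gt0.
Qed.

Lemma sine_lt0 x : - N < x < 0 -> s x < 0.
Proof.
by move=> /andP[x0 xN]; rewrite -[x]opprK sineN oppr_lt0 sine_gt0//; apply/andP; split; lra.
Qed.

Lemma sine_le0 x : - N <= x <= 0 -> s x <= 0.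
Proof.
by move=> /andP[x0 xN]; rewrite -[x]opprK sineN oppr_le0 sine_ge0//; apply/andP; split; lra.
Qed.

Lemma chord_ngon a b u : chord a b (P u) = s (u - a) * s (u - b).
Proof.
rewrite /chord abscissa_vertex ordinate_vertex.
have -> : co (b - a) = co ((u - a) - (u - b)) by congr cosine; ring.
have -> : a + b = 2 * u - ((u - a) + (u - b)) by ring.
set x := u - a; set y := u - b.
rewrite !(cosineB (2 * u)) (sineB (2 * u)) (cosineB x y) (cosineD x y) (sineD x y).
transitivity ((co x * co y + s x * s y
 - (co (2 * u) ^+ 2 + s (2 * u) ^+ 2) * (co x * co y - s x * s y)) / 2).
  by congr (_ / _); ring.
by rewrite cosine2_sine2; field.
Qed.

Lemma ngonDn x : P (x + N) = P x.
Proof.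
have e : theta + 2 * (x + N) * (pi / N) = theta + 2 * x * (pi / N) + pi *+ 2.
  by rewrite -mulr_natr; field; rewrite gt_eqF.
by rewrite /ngon e sinD2pi cosD2pi.
Qed.

Lemma ngonDMn x (k : nat) : P (x + k%:R * N) = P x.
Proof.
elim: k => [|k IH]; first by rewrite mul0r addr0.
by rewrite -natr1 mulrDl mul1r addrA ngonDn.
Qed.

Lemma int_ltD1 u v : u \is a Num.int -> v \is a Num.int -> u < v -> u + 1 <= v.
Proof.
move=> /intrP[k ->] /intrP[m ->]; rewrite ltr_int => km.
by rewrite -[1]/(1%:~R) -intrD ler_int; lia.
Qed.

Lemma ngon_window u a : u \is a Num.int -> a \is a Num.int ->
  exists2 v, v \is a Num.int & a <= v < a + N /\ P v = P u.
Proof.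
move=> /intrP[k ->] /intrP[m ->].
pose d := ((k - m) %% n)%Z; pose q := ((k - m) %/ n)%Z.
have n0 : (n : int) != 0 by lia.
have kE : k = m + d + q * n by rewrite /d /q; have := divz_eq (k - m) n; lia.
have d0 : 0 <= d by rewrite modz_ge0.
have dn : d < n by rewrite /d; apply: ltz_pmod; lia.
exists (m + d)%:~R; first exact: intr_int.
split.
  rewrite intrD lerDl ler0z d0 ltrD2l /=.
  by rewrite -[N]/((n : int)%:~R) ltr_int.
have [q0|q0] := leP 0 q.
  have -> : (k%:~R : R) = (m + d)%:~R + (`|q|%N)%:R * N.
    by rewrite {1}kE intrD intrM -{1}(gez0_abs q0) !pmulrn.
  by rewrite ngonDMn.
have -> : ((m + d)%:~R : R) = k%:~R + (`|q|%N)%:R * N.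
  have q1 : (`|q|%N : int) = - q by rewrite -ltz0_abs.
  rewrite !pmulrn -intrM -intrD q1; congr (_%:~R); lia.
by rewrite ngonDMn.
Qed.

(** The case [u = v] accounts for the vertices themselves. *)
Definition ngon_drawing : set pt := [set z | exists u v,
  [/\ u \is a Num.int, v \is a Num.int & segment (P u) (P v) z]].
Local Notation Dn := ngon_drawing.

Lemma drawing_window a z : a \is a Num.int -> Dn z -> exists u v,
  [/\ u \is a Num.int, v \is a Num.int, a <= u < a + N, a <= v < a + N &
      segment (P u) (P v) z].
Proof.
move=> aZ [u [v [uZ vZ zs]]].
have [u' u'Z [u'a Pu]] := ngon_window uZ aZ.
have [v' v'Z [v'a Pv]] := ngon_window vZ aZ.
by exists u', v'; split=> //; rewrite Pu Pv.
Qed.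

(** The drawing depends on the set of vertices only, not on their numbering. *)
Lemma drawing_setE (p : 'I_n -> pt) : range p = range (@regular_ngon R n c r theta) ->
  drawing_set p = Dn.
Proof.
move=> rp.
have regE (i : 'I_n) : regular_ngon c r theta i = P i%:R.
  have e : theta + 2 * pi * i%:R / n%:R = theta + 2 * i%:R * (pi / N).
    by field; rewrite gt_eqF.
  by rewrite /regular_ngon e.
have pP i : exists j : 'I_n, p i = P j%:R.
  have [j _ <-] : range (@regular_ngon R n c r theta) (p i) by rewrite -rp; exists i.
  by exists j; rewrite regE.
have Pp u : u \is a Num.int -> exists i, p i = P u.
  move=> uZ; have [v vZ [/andP[v0 vN] <-]] := ngon_window uZ (rpred0 _).
  have : range p (P v).
    have /intrP[k vk] := vZ; case: k vk => [k|k] vk; last first.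
      by exfalso; move: v0; rewrite vk ler0z.
    have kn : (k < n)%N by move: vN; rewrite vk add0r -pmulrn ltr_nat.
    by rewrite rp; exists (Ordinal kn) => //; rewrite regE vk.
  by move=> [i _ <-]; exists i.
apply/seteqP; split=> z.
  move=> [[i _ <-]|[[i j] _ /=]].
    have [k ->] := pP i; exists k%:R, k%:R; split; try exact: natr_int.
    by exists 0; rewrite /= ?ler01 ?lexx// subr0 scale1r scale0r addr0.
  have [k ->] := pP i; have [m ->] := pP j => zs.
  by exists k%:R, m%:R; split=> //; exact: natr_int.
move=> [u [v [uZ vZ]]]; have [i <-] := Pp u uZ; have [j <-] := Pp v vZ.
have [->|ij] := eqVneq i j.
  by move=> [t _ <-]; left; exists j => //; rewrite -scalerDl subrK scale1r.
by move=> zs; right; exists (i, j).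
Qed.

Definition inside z := forall a, a \is a Num.int -> 0 <= chord a (a + 1) z.

Lemma inside_ngon u : u \is a Num.int -> inside (P u).
Proof.
move=> uZ a aZ; have [v vZ [/andP[v0 vN] <-]] := ngon_window uZ aZ.
rewrite chord_ngon; have [->|va] := eqVneq v a; first by rewrite subrr sine0 mul0r.
have av : a + 1 <= v by apply: int_ltD1 => //; rewrite lt_neqAle eq_sym va.
by rewrite mulr_ge0// sine_ge0//; apply/andP; split; lra.
Qed.

Lemma inside_cvx : cvx inside.
Proof.
move=> x y t t01 ix iy a aZ.
exact: (affine_cvx_ge (chord_affine a (a + 1)) t01 (ix a aZ) (iy a aZ)).
Qed.

Lemma inside_drawing z : Dn z -> inside z.
Proof.
move=> [u [v [uZ vZ]]]; apply: cvx_segment; first exact: inside_cvx.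
  exact: inside_ngon.
exact: inside_ngon.
Qed.

(** The two sides that meet at vertex [a], added: zero there and positive at
    every other vertex. *)
Let corner a z := chord (a - 1) (a - 1 + 1) z + chord a (a + 1) z.

Let corner_affine a : affine (corner a).
Proof. by apply: affineD; exact: chord_affine. Qed.

Let corner0 a : corner a (P a) = 0.
Proof. by rewrite /corner !chord_ngon subrK subrr sine0; ring. Qed.

Let corner_gt0 a b : a \is a Num.int -> b \is a Num.int -> a < b < a + N ->
  0 < corner a (P b).
Proof.
move=> aZ bZ /andP[ab bN]; rewrite /corner !chord_ngon.
have ab1 := int_ltD1 aZ bZ ab.
have : b + 1 <= a + N by apply: int_ltD1 => //; rewrite rpredD ?natr_int.
move=> bN1; have sb : 0 < s (b - a) by apply: sine_gt0; apply/andP; split; lra.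
have h1 : 0 <= s (b - (a - 1)) by apply: sine_ge0; apply/andP; split; lra.
have h2 : 0 <= s (b - (a + 1)) by apply: sine_ge0; apply/andP; split; lra.
have -> : b - (a - 1 + 1) = b - a by ring.
have [h|h] := ltP (a + 1) b.
  have : 0 < s (b - (a + 1)) by apply: sine_gt0; apply/andP; split; lra.
  by nra.
have : 0 < s (b - (a - 1)) by apply: sine_gt0; have := N_ge3 => ?; apply/andP; split; lra.
by nra.
Qed.

(** Inside the polygon the line of a chord reduces to the chord: the two
    [corner] functions at its ends bound the position on the line. *)
Lemma on_chord a b z : a \is a Num.int -> b \is a Num.int -> a < b < a + N ->
  inside z -> chord a b z = 0 -> segment (P a) (P b) z.
Proof.
move=> aZ bZ abN iz z0; have /andP[ab bN] := abN.
have ca := corner_gt0 aZ bZ abN.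
have cb : 0 < corner b (P a).
  by rewrite -(ngonDn a); apply: corner_gt0 => //; [rewrite rpredD ?natr_int|apply/andP; split; lra].
(* the point of index a + 1/2, halfway along an arc, is off the chord *)
have [||||||t zE] := @affine_zero_line R (chord a b) (P a) (P b) (P (a + 2^-1)) z.
- exact: chord_affine.
- by apply: contraTneq ca => <-; rewrite corner0 ltxx.
- by rewrite chord_ngon subrr sine0 mul0r.
- by rewrite chord_ngon subrr sine0 mulr0.
- rewrite chord_ngon mulf_neq0//; [rewrite gt_eqF//|rewrite lt_eqF//].
    by apply: sine_gt0; have := N_ge3 => ?; apply/andP; split; lra.
  by have := int_ltD1 aZ bZ ab => ?; apply: sine_lt0; apply/andP; split; lra.
- by [].
exists t => //=.
have corner_ge0 a' : a' \is a Num.int -> 0 <= corner a' z.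
  by move=> a'Z; rewrite addr_ge0// iz// rpredB ?rpred1.
have := corner_ge0 a aZ; have := corner_ge0 b bZ.
rewrite zE !affineP; try exact: corner_affine.
rewrite !corner0 => h1 h2.
by apply/andP; split; nra.
Qed.

(** * The pentagon between two pencils of chords *)

(** Up to a positive factor, the value of [chord (-1) 2] at the crossing of the
    chords from 0 to [j] and from 1 to [- i]; it is positive when the crossing
    is separated from the side 01 by the chord from -1 to 2. *)
Definition crossing_height i j : R := s (i - 1) * s (j - 2) - s 1 * s (i + j).

Lemma ptolemy x y j : s x * s (j + y) - s (j + x) * s y = s j * s (x - y).
Proof.
rewrite !(sineD j) sineB. 
set sx := s x; set cx := co x; set sy := s y; set cy := co y; set sj := s j; set cj := co j.
ring.
Qed.

(** [sine_identity1] and [sine_identity2] evaluate the determinant of the lines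
    (0, j), (1, -i) and (-1, 2), each time dividing out other sines, according
    to which two of the lines are intersected first. *)
Lemma sine_identity1 i j :
  s 2 * s (i + j) * s (j - 1) - s (j + 1) * s (j - 2) * s i = - (s j * crossing_height i j).
Proof.
rewrite /crossing_height !sineB !sineD ?cosineD.
have h1 := cosine2_sine2 1; have hi := cosine2_sine2 i; have hj := cosine2_sine2 j.
move: h1 hi hj.
set si := s i; set ci := co i; set sj := s j; set cj := co j.
set s1 := s 1; set c1 := co 1 => h1 hi hj.
ring: h1 hi hj.
Qed.

Lemma sine_identity2 i j :
  s i * s (i + j) * s 2 - s (j - 1) * s (i - 1) * s (i + 2) = - (s (i + 1) * crossing_height i j).
Proof.
rewrite /crossing_height !sineB !sineD ?cosineD.
have h1 := cosine2_sine2 1; have hi := cosine2_sine2 i; have hj := cosine2_sine2 j.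
move: h1 hi hj.
set si := s i; set ci := co i; set sj := s j; set cj := co j.
set s1 := s 1; set c1 := co 1 => h1 hi hj.
ring: h1 hi hj.
Qed.

(** The crossing of the chords (a, b) and (u, v) is written as a weighted mean
    of the ends of the first one, which keeps it visibly on that chord. *)
Definition cross_weight a b u v := chord u v (P a) / (chord u v (P a) - chord u v (P b)).
Definition meet a b u v : pt :=
  (1 - cross_weight a b u v) *: P a + cross_weight a b u v *: P b.

Lemma chord_meet e g a b u v : chord u v (P b) < 0 -> 0 < chord u v (P a) ->
  exists2 d, 0 < d & chord e g (meet a b u v) =
    d * (s (a - u) * s (a - v) * (s (b - e) * s (b - g))
       - s (b - u) * s (b - v) * (s (a - e) * s (a - g))).
Proof.
move=> hb ha; exists (chord u v (P a) - chord u v (P b))^-1.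
  by rewrite invr_gt0; lra.
rewrite /meet affineP; last exact: chord_affine.
rewrite -!chord_ngon /cross_weight; field; rewrite gt_eqF//; lra.
Qed.

Lemma segment_meet a b u v : chord u v (P b) < 0 -> 0 < chord u v (P a) ->
  segment (P a) (P b) (meet a b u v).
Proof.
move=> hb ha; exists (cross_weight a b u v) => //=.
have d : 0 < chord u v (P a) - chord u v (P b) by lra.
apply/andP; split; first exact: divr_ge0 (ltW ha) (ltW d).
by rewrite ler_pdivrMr// mul1r; lra.
Qed.

Lemma inside_meet a b u v : a \is a Num.int -> b \is a Num.int ->
  chord u v (P b) < 0 -> 0 < chord u v (P a) -> inside (meet a b u v).
Proof.
move=> aZ bZ hb ha; apply: (cvx_segment inside_cvx _ _ (segment_meet hb ha)); exact: inside_ngon.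
Qed.

(** The polygon is cut out by lines of chords; as its corners lie in the n-gon,
    [on_chord] turns its edges into parts of the chords. *)
Lemma chord_polygon_face (k : nat) (e : 'I_k -> pt -> R) (v : 'I_k -> pt) (a b : 'I_k -> R) :
  polygon e v ->
  (forall i, [/\ a i \is a Num.int, b i \is a Num.int & a i < b i < a i + N]) ->
  (forall i, e i = chord (a i) (b i) \/ e i = (fun z => - chord (a i) (b i) z)) ->
  (forall i, inside (v i)) -> (forall z, Dn z -> exists i, e i z <= 0) ->
  exists F, k_face k Dn F.
Proof.
move=> pol abZ eab iv De; exists (interior (conv_hull (range v))).
apply: (polygon_k_face pol _ De) => i.
have [aZ bZ ab] := abZ i.
have on (y : pt) : inside y -> e i y = 0 -> segment (P (a i)) (P (b i)) y.
  move=> iy ey; apply: on_chord => //; have [] := eab i => ei; move: ey; rewrite ei//.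
  by move=> /eqP; rewrite oppr_eq0 => /eqP.
move=> z zs; exists (a i), (b i); split=> //.
apply: (cvx_segment (@segment_cvx R _ _) _ _ zs); apply: on => //.
  exact: (polygon_start pol).
exact: (polygon_end pol).
Qed.

(** The chords from 0 and those from 1 form two pencils, crossing each other at
    [pencil_corner] and meeting the chord from -1 to 2 at [right_corner] and
    [left_corner]. *)
Definition pencil_corner i j := meet j 0 (- i) 1.
Definition left_corner i := meet (- i) 1 (-1) 2.
Definition right_corner j := meet j 0 (-1) 2.
Definition pencil_ok i j := [/\ 0 < i, 1 < j & i + j < N].
Definition left_ok i := 1 < i /\ i + 2 < N.
Definition right_ok j := 2 < j /\ j + 1 < N.

Lemma sine1_gt0 : 0 < s 1.
Proof. by apply: sine_gt0; have := N_ge3 => ?; apply/andP; split; lra. Qed.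
Lemma sine2_gt0 : 0 < s 2.
Proof. by apply: sine_gt0; have := N_ge3 => ?; apply/andP; split; lra. Qed.

Ltac sgt0 := by apply: sine_gt0; have := N_ge3 => ?; apply/andP; split; lra.

Lemma pencil_start i j : pencil_ok i j -> chord (- i) 1 (P 0) < 0.
Proof.
move=> [i0 j1 ij]; rewrite chord_ngon.
have -> : 0 - - i = i by ring.
have -> : 0 - 1 = - 1 :> R by ring.
rewrite sineN mulrN oppr_lt0 mulr_gt0 ?sine1_gt0//; sgt0.
Qed.

Lemma pencil_stop i j : pencil_ok i j -> 0 < chord (- i) 1 (P j).
Proof.
move=> [i0 j1 ij]; rewrite chord_ngon mulr_gt0//; sgt0.
Qed.

Lemma left_start i : left_ok i -> chord (-1) 2 (P 1) < 0.
Proof.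
move=> _; rewrite chord_ngon.
have -> : 1 - -1 = 2 :> R by ring.
have -> : 1 - 2 = - 1 :> R by ring.
by rewrite sineN mulrN oppr_lt0 mulr_gt0 ?sine1_gt0 ?sine2_gt0.
Qed.

Lemma left_stop i : left_ok i -> 0 < chord (-1) 2 (P (- i)).
Proof.
move=> [i1 i2]; rewrite chord_ngon.
have -> : - i - -1 = - (i - 1) by ring.
have -> : - i - 2 = - (i + 2) by ring.
by rewrite !sineN mulrNN mulr_gt0//; sgt0.
Qed.

Lemma right_start j : right_ok j -> chord (-1) 2 (P 0) < 0.
Proof.
move=> _; rewrite chord_ngon.
have -> : 0 - -1 = 1 :> R by ring.
have -> : 0 - 2 = - 2 :> R by ring.
by rewrite sineN mulrN oppr_lt0 mulr_gt0 ?sine1_gt0 ?sine2_gt0.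
Qed.

Lemma right_stop j : right_ok j -> 0 < chord (-1) 2 (P j).
Proof.
move=> [j2 jN]; rewrite chord_ngon.
have -> : j - -1 = j + 1 by ring.
by rewrite mulr_gt0//; sgt0.
Qed.

(** The next lemmas give the values at the three kinds of crossings of the lines
    that bound the pentagon, up to positive factors [d]; the numbers 0, 1, 2 in
    their names stand for the lines from 0, from 1, and from -1 to 2. *)
Lemma chord0_pencil i j y : pencil_ok i j ->
  exists2 d, 0 < d & chord 0 y (pencil_corner i j) = d * s (j - y).
Proof.
move=> h; have [d d0 ->] := @chord_meet 0 y j 0 (- i) 1 (pencil_start h) (pencil_stop h).
case: h => i0 j1 ij.
have si : 0 < s i by sgt0.
have sj : 0 < s j by sgt0.
exists (d * (s i * s 1 * s j)); first by rewrite !mulr_gt0// sine1_gt0.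
have -> : 0 - 1 = - 1 :> R by ring.
by rewrite subrr sine0 subr0 !opprK !add0r !sineN; ring.
Qed.

Lemma chord1_pencil i j y : pencil_ok i j ->
  exists2 d, 0 < d & chord (- y) 1 (pencil_corner i j) = d * s (i - y).
Proof.
move=> h; have [d d0 ->] := @chord_meet (- y) 1 j 0 (- i) 1 (pencil_start h) (pencil_stop h).
case: h => i0 j1 ij.
have sj1 : 0 < s (j - 1) by sgt0.
have sj : 0 < s j by sgt0.
exists (d * (s 1 * s (j - 1) * s j)); first by rewrite !mulr_gt0// sine1_gt0.
have -> : 0 - 1 = - 1 :> R by ring.
rewrite !opprK !add0r sineN.
transitivity (d * s 1 * s (j - 1) * (s j * s (i - y))); last by ring.
by rewrite -(ptolemy i y j); ring.
Qed.

Lemma chord2_pencil i j : pencil_ok i j ->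
  exists2 d, 0 < d & chord (-1) 2 (pencil_corner i j) = d * crossing_height i j.
Proof.
move=> h; have [d d0 ->] := @chord_meet (-1) 2 j 0 (- i) 1 (pencil_start h) (pencil_stop h).
case: h => i0 j1 ij.
have sj : 0 < s j by sgt0.
exists (d * (s 1 * s j)); first by rewrite !mulr_gt0// sine1_gt0.
have -> : 0 - 1 = - 1 :> R by ring.
have -> : 0 - 2 = - 2 :> R by ring.
rewrite !opprK !add0r !sineN.
transitivity (- (d * s 1 * - (s j * crossing_height i j))); last by ring.
by rewrite -(sine_identity1 i j) [i + j]addrC; ring.
Qed.

Lemma chord0_left i y : left_ok i ->
  exists2 d, 0 < d & chord 0 y (left_corner i) = - (d * crossing_height i y).
Proof.
move=> h; have [d d0 ->] := @chord_meet 0 y (- i) 1 (-1) 2 (left_start h) (left_stop h).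
case: h => i1 iN.
have si : 0 < s (i + 1) by sgt0.
exists (d * (s 1 * s (i + 1))); first by rewrite !mulr_gt0// sine1_gt0.
have -> : - i - -1 = - (i - 1) by ring.
have -> : - i - 2 = - (i + 2) by ring.
have -> : - i - y = - (i + y) by ring.
have -> : 1 - -1 = 2 :> R by ring.
have -> : 1 - 2 = - 1 :> R by ring.
have -> : 1 - y = - (y - 1) :> R by ring.
rewrite !subr0 !sineN.
transitivity (d * s 1 * - (s (i + 1) * crossing_height i y)); last by ring.
by rewrite -(sine_identity2 i y); ring.
Qed.

Lemma chord1_left i y : left_ok i ->
  exists2 d, 0 < d & chord (- y) 1 (left_corner i) = d * s (i - y).
Proof.
move=> h; have [d d0 ->] := @chord_meet (- y) 1 (- i) 1 (-1) 2 (left_start h) (left_stop h).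
case: h => i1 iN.
have si : 0 < s (i + 1) by sgt0.
exists (d * (s 1 * s 2 * s (i + 1))); first by rewrite !mulr_gt0// ?sine1_gt0 ?sine2_gt0.
have -> : - i - - y = - (i - y) by ring.
have -> : - i - 1 = - (i + 1) by ring.
have -> : 1 - -1 = 2 :> R by ring.
have -> : 1 - 2 = - 1 :> R by ring.
by rewrite subrr sine0 !sineN; ring.
Qed.

Lemma chord0_right j y : right_ok j ->
  exists2 d, 0 < d & chord 0 y (right_corner j) = d * s (j - y).
Proof.
move=> h; have [d d0 ->] := @chord_meet 0 y j 0 (-1) 2 (right_start h) (right_stop h).
case: h => j2 jN.
have sj : 0 < s j by sgt0.
exists (d * (s 1 * s 2 * s j)); first by rewrite !mulr_gt0// ?sine1_gt0 ?sine2_gt0.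
have -> : 0 - 2 = - 2 :> R by ring.
by rewrite subrr sine0 subr0 !opprK !add0r !sineN; ring.
Qed.

Lemma chord1_right j y : right_ok j ->
  exists2 d, 0 < d & chord (- y) 1 (right_corner j) = - (d * crossing_height y j).
Proof.
move=> h; have [d d0 ->] := @chord_meet (- y) 1 j 0 (-1) 2 (right_start h) (right_stop h).
case: h => j2 jN.
have sj : 0 < s j by sgt0.
exists (d * (s 1 * s j)); first by rewrite !mulr_gt0// sine1_gt0.
have -> : 0 - 1 = - 1 :> R by ring.
have -> : 0 - 2 = - 2 :> R by ring.
rewrite !opprK !add0r !sineN.
transitivity (d * s 1 * - (s j * crossing_height y j)); last by ring.
by rewrite -(sine_identity1 y j) [y + j]addrC; ring.
Qed.

Lemma chord_meet_other a b u v : chord u v (P b) < 0 -> 0 < chord u v (P a) ->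
  chord u v (meet a b u v) = 0.
Proof. by move=> hb ha; have [d _ ->] := chord_meet u v hb ha; ring. Qed.

Lemma polygon5 (e0 e1 e2 e3 e4 : pt -> R) (v0 v1 v2 v3 v4 : pt)
    (e := fun i : 'I_5 => nth e0 [:: e0; e1; e2; e3; e4] i)
    (v := fun i : 'I_5 => nth v0 [:: v0; v1; v2; v3; v4] i) :
  (forall i, affine (e i)) ->
  [/\ e0 v0 = 0, e0 v1 = 0, 0 < e0 v2, 0 < e0 v3 & 0 < e0 v4] ->
  [/\ e1 v1 = 0, e1 v2 = 0, 0 < e1 v3, 0 < e1 v4 & 0 < e1 v0] ->
  [/\ e2 v2 = 0, e2 v3 = 0, 0 < e2 v4, 0 < e2 v0 & 0 < e2 v1] ->
  [/\ e3 v3 = 0, e3 v4 = 0, 0 < e3 v0, 0 < e3 v1 & 0 < e3 v2] ->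
  [/\ e4 v4 = 0, e4 v0 = 0, 0 < e4 v1, 0 < e4 v2 & 0 < e4 v3] ->
  polygon e v.
Proof.
move=> ea [? ? ? ? ?] [? ? ? ? ?] [? ? ? ? ?] [? ? ? ? ?] [? ? ? ? ?].
split=> //.
- by move=> [[|[|[|[|[|i]]]]] ?].
- by move=> [[|[|[|[|[|i]]]]] ?].
- by move=> [[|[|[|[|[|i]]]]] ?] [[|[|[|[|[|j]]]]] ?].
Qed.

(** A chord from 0 or from 1 stays outside the gap between two consecutive
    chords of its pencil; a chord with neither 0 nor 1 as an end has both ends
    weakly beyond the chord from -1 to 2. *)
Lemma pencil_exclusion i j z : i \is a Num.int -> j \is a Num.int ->
  1 <= i -> 2 <= j -> i + j + 2 <= N -> Dn z ->
  chord 0 j z <= 0 \/ 0 <= chord (- (i + 1)) 1 z \/ 0 <= chord (-1) 2 z \/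
  0 <= chord 0 (j + 1) z \/ chord (- i) 1 z <= 0.
Proof.
move=> iZ jZ i1 j2 ijN; set Q := _ \/ _.
have ZN1 : -1 \is a @Num.int R by rewrite rpredN rpred1.
have Z1 : 1 \is a @Num.int R := rpred1 _.
have Z0 : 0 \is a @Num.int R := rpred0 _.
move=> /(drawing_window ZN1)[a [b [aZ bZ /andP[a1 aN] /andP[b1 bN]]]].
have case0 u : u \is a Num.int -> -1 <= u -> u < -1 + N -> segment (P 0) (P u) z -> Q.
  move=> uZ u1 uN zs; have [u0|u0] := ltP u 0.
    have {}u0 : u = -1 by apply/eqP; rewrite eq_le u1 andbT; have := int_ltD1 uZ Z0 u0; lra.
    do 3!right; left; apply: affine_segment_ge0 (chord_affine _ _) _ _ zs.
      by rewrite chord_ngon subrr sine0 mul0r.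
    rewrite u0 chord_ngon; apply: mulr_le0; apply: sine_le0; apply/andP; split; lra.
  have [uj|uj] := leP u j.
    left; apply: affine_segment_le0 (chord_affine _ _) _ _ zs.
      by rewrite chord_ngon subrr sine0 mul0r.
    rewrite chord_ngon; apply: mulr_ge0_le0; [apply: sine_ge0|apply: sine_le0]; apply/andP; split; lra.
  have {}uj := int_ltD1 jZ uZ uj.
  do 3!right; left; apply: affine_segment_ge0 (chord_affine _ _) _ _ zs.
    by rewrite chord_ngon subrr sine0 mul0r.
  rewrite chord_ngon; apply: mulr_ge0; apply: sine_ge0; apply/andP; split; lra.
have case1 u : u \is a Num.int -> -1 <= u -> u < -1 + N -> segment (P 1) (P u) z -> Q.
  move=> uZ u1 uN zs; have [u0|u0] := ltP u 1.
    have {}u0 := int_ltD1 uZ Z1 u0.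
    do 4!right; apply: affine_segment_le0 (chord_affine _ _) _ _ zs.
      by rewrite chord_ngon subrr sine0 mulr0.
    rewrite chord_ngon; apply: mulr_ge0_le0; [apply: sine_ge0|apply: sine_le0]; apply/andP; split; lra.
  have [uj|uj] := leP (u + (i + 1)) N.
    right; left; apply: affine_segment_ge0 (chord_affine _ _) _ _ zs.
      by rewrite chord_ngon subrr sine0 mulr0.
    rewrite chord_ngon; apply: mulr_ge0; apply: sine_ge0; apply/andP; split; lra.
  have {}uj : N + 1 <= u + (i + 1) by apply: int_ltD1; rewrite ?rpredD ?natr_int.
  do 4!right; apply: affine_segment_le0 (chord_affine _ _) _ _ zs.
    by rewrite chord_ngon subrr sine0 mulr0.
  rewrite chord_ngon; apply: mulr_le0_ge0; last by apply: sine_ge0; apply/andP; split; lra.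
  have -> : u - - i = (u + i - N) + N by ring.
  by rewrite sineDn oppr_le0; apply: sine_ge0; apply/andP; split; lra.
have [->|a0] := eqVneq a 0; first exact: case0.
have [->|b0] := eqVneq b 0; first by move=> /segmentC; exact: case0.
have [->|a1'] := eqVneq a 1; first exact: case1.
have [->|b1'] := eqVneq b 1; first by move=> /segmentC; exact: case1.
have away u : u \is a Num.int -> -1 <= u -> u < -1 + N -> u != 0 -> u != 1 ->
    0 <= chord (-1) 2 (P u).
  move=> uZ u1 uN u0 u1'; rewrite chord_ngon.
  have [h|h] := ltP u 0.
    have -> : u = -1.
      by apply/eqP; rewrite eq_le u1 andbT; have := int_ltD1 uZ Z0 h; lra.
    by rewrite subrr sine0 mul0r.
  have {}h : 0 + 1 <= u by apply: int_ltD1 => //; rewrite lt_neqAle eq_sym u0.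
  have {}h : 1 + 1 <= u by apply: int_ltD1 => //; rewrite lt_neqAle eq_sym u1'; lra.
  by apply: mulr_ge0; apply: sine_ge0; apply/andP; split; lra.
move=> zs; do 2!right; left; apply: affine_segment_ge0 (chord_affine _ _) _ _ zs.
  exact: away.
exact: away.
Qed.

(** Of the four corners of the quadrilateral between the two pairs of
    consecutive chords, the chord from -1 to 2 cuts off only the one of index
    (i + 1, j + 1).  The bound on [i + j] lets the two cut chords meet at a
    vertex of the polygon at worst. *)
Lemma pencil_pentagon i j : i \is a Num.int -> j \is a Num.int ->
  1 <= i -> 2 <= j -> i + j + 2 <= N ->
  crossing_height i j < 0 -> crossing_height (i + 1) j < 0 -> crossing_height i (j + 1) < 0 -> 0 < crossing_height (i + 1) (j + 1) ->
  exists F, k_face 5 Dn F.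
Proof.
move=> iZ jZ i1 j2 ijN fij fi fj fij1.
have g1 : pencil_ok i j by split; lra.
have g2 : pencil_ok (i + 1) j by split; lra.
have g3 : pencil_ok i (j + 1) by split; lra.
have u : left_ok (i + 1) by split; lra.
have w : right_ok (j + 1) by split; lra.
have sN1 : s (-1) < 0 by rewrite sineN oppr_lt0 sine1_gt0.
have i1Z : i + 1 \is a Num.int by rewrite rpredD ?rpred1.
have j1Z : j + 1 \is a Num.int by rewrite rpredD ?rpred1.
have ZN1 : -1 \is a @Num.int R by rewrite rpredN rpred1.
(* each edge starts at the corner with the same position in the two lists *)
have pol := @polygon5 (chord 0 j) (fun z => - chord (- (i + 1)) 1 z)
  (fun z => - chord (-1) 2 z) (fun z => - chord 0 (j + 1) z) (chord (- i) 1)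
  (pencil_corner i j) (pencil_corner (i + 1) j) (left_corner (i + 1)) (right_corner (j + 1)) (pencil_corner i (j + 1)).
have {}pol := pol _ _ _ _ _ _.
apply: (@chord_polygon_face 5 _ _
  (fun k => nth 0 [:: 0; - (i + 1); -1; 0; - i] k)
  (fun k => nth 0 [:: j; 1; 2; j + 1; 1] k) (pol _ _ _ _ _ _)).
- move=> [[|[|[|[|[|k]]]]] hk] //=; do ?[exact: chord_affine]; apply: affineN; exact: chord_affine.
- split.
  + by have [d _ ->] := chord0_pencil j g1; rewrite subrr sine0 mulr0.
  + by have [d _ ->] := chord0_pencil j g2; rewrite subrr sine0 mulr0.
  + by have [d d0 ->] := chord0_left j u; nra.
  + by have [d d0 ->] := chord0_right j w; rewrite addrC addKr mulr_gt0 ?sine1_gt0.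
  + by have [d d0 ->] := chord0_pencil j g3; rewrite addrC addKr mulr_gt0 ?sine1_gt0.
- split.
  + by have [d _ ->] := chord1_pencil (i + 1) g2; rewrite subrr sine0 mulr0 oppr0.
  + by have [d _ ->] := chord1_left (i + 1) u; rewrite subrr sine0 mulr0 oppr0.
  + by have [d d0 ->] := chord1_right (i + 1) w; nra.
  + have [d d0 ->] := chord1_pencil (i + 1) g3; rewrite opprD addNKr; nra.
  + have [d d0 ->] := chord1_pencil (i + 1) g1; rewrite opprD addNKr; nra.
- split.
  + by rewrite (chord_meet_other (left_start u) (left_stop u)) oppr0.
  + by rewrite (chord_meet_other (right_start w) (right_stop w)) oppr0.
  + by have [d d0 ->] := chord2_pencil g3; nra.
  + by have [d d0 ->] := chord2_pencil g1; nra.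
  + by have [d d0 ->] := chord2_pencil g2; nra.
- split.
  + by have [d _ ->] := chord0_right (j + 1) w; rewrite subrr sine0 mulr0 oppr0.
  + by have [d _ ->] := chord0_pencil (j + 1) g3; rewrite subrr sine0 mulr0 oppr0.
  + have [d d0 ->] := chord0_pencil (j + 1) g1; rewrite opprD addNKr; nra.
  + have [d d0 ->] := chord0_pencil (j + 1) g2; rewrite opprD addNKr; nra.
  + by have [d d0 ->] := chord0_left (j + 1) u; nra.
- split.
  + by have [d _ ->] := chord1_pencil i g3; rewrite subrr sine0 mulr0.
  + by have [d _ ->] := chord1_pencil i g1; rewrite subrr sine0 mulr0.
  + by have [d d0 ->] := chord1_pencil i g2; rewrite addrC addKr mulr_gt0 ?sine1_gt0.
  + by have [d d0 ->] := chord1_left i u; rewrite addrC addKr mulr_gt0 ?sine1_gt0.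
  + by have [d d0 ->] := chord1_right i w; nra.
- by move=> [[|[|[|[|[|k]]]]] hk] //=; split; rewrite ?rpredN ?rpred0 ?rpred1//; lra.
- by move=> [[|[|[|[|[|k]]]]] hk] //=; (left + right).
- have gin i' j' : i' \is a Num.int -> j' \is a Num.int -> pencil_ok i' j' -> inside (pencil_corner i' j').
    by move=> i'Z j'Z g; apply: inside_meet (pencil_start g) (pencil_stop g); rewrite ?rpred0.
  have uin : inside (left_corner (i + 1)).
    by apply: inside_meet (left_start u) (left_stop u); rewrite ?rpredN ?rpred1.
  have win : inside (right_corner (j + 1)).
    by apply: inside_meet (right_start w) (right_stop w); rewrite ?rpred0.
  have gin1 := gin _ _ iZ jZ g1; have gin2 := gin _ _ i1Z jZ g2.
  have gin3 := gin _ _ iZ j1Z g3.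
  by move=> [[|[|[|[|[|k]]]]] hk] //=.
move=> z /(pencil_exclusion iZ jZ i1 j2 ijN) => -[|[|[|[|]]]] h.
- by exists (@Ordinal 5 0 isT).
- by exists (@Ordinal 5 1 isT) => /=; rewrite oppr_le0.
- by exists (@Ordinal 5 2 isT) => /=; rewrite oppr_le0.
- by exists (@Ordinal 5 3 isT) => /=; rewrite oppr_le0.
- by exists (@Ordinal 5 4 isT).
Qed.

(** * Choosing the pencils *)

Lemma cosine_decr x u : 0 <= x -> x < u -> u <= N -> co u < co x.
Proof.
move=> x0 xu uN; have pN : 0 < pi / N by rewrite divr_gt0 ?pi_gt0.
have uNpi : u * (pi / N) <= pi.
  by rewrite mulrA ler_pdivrMr// mulrC ler_pM2l ?pi_gt0.
rewrite /cosine ltr_cos ?ltr_pM2r// in_itv /= ?uNpi.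
  by rewrite mulr_ge0 ?(ltW pN)//= (le_trans _ uNpi)// ler_pM2r// ltW.
by rewrite andbT mulr_ge0 ?(ltW pN)//; lra.
Qed.

Lemma cosine_half : co (N / 2) = 0.
Proof.
rewrite /cosine; have -> : N / 2 * (pi / N) = pi / 2 by field; rewrite gt_eqF.
exact: cos_pihalf.
Qed.

(** The triple angle formula gives (x + 1)(2x - 1)^2 = 0 for x = cos(pi/3). *)
Lemma cosine_third : co (N / 3) = 2^-1.
Proof.
have h : co (N / 3 + N / 3 + N / 3) = -1 by rewrite -cosine_n; congr cosine; field.
have hp : 0 < co (N / 3).
  by rewrite -cosine_half; apply: cosine_decr; have := N_ge3 => ?; lra.
move: h; rewrite !cosineD !sineD; have h1 := cosine2_sine2 (N / 3).
set x := co _ in hp h1 *; set y := s _ in h1 * => h.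
have y2 : y ^+ 2 = 1 - x ^+ 2 by rewrite h1; ring.
have : (x + 1) * (2 * x - 1) ^+ 2 = 0.
  transitivity ((x * x - y * y) * x - (y * x + x * y) * y + 1); first by ring: y2.
  by rewrite h addNr.
move/eqP; rewrite mulf_eq0 expf_eq0 /= => /orP[/eqP|/eqP]; lra.
Qed.

Lemma cosine_gt0 x : 0 <= x -> 2 * x < N -> 0 < co x.
Proof. by move=> x0 xN; rewrite -cosine_half; apply: cosine_decr; lra. Qed.
Lemma cosine_lt0 x : x <= N -> N < 2 * x -> co x < 0.
Proof. by move=> x0 xN; rewrite -cosine_half; apply: cosine_decr; lra. Qed.
Lemma cosine_gt_half x : 0 <= x -> 3 * x < N -> 2^-1 < co x.
Proof. by move=> x0 xN; rewrite -cosine_third; apply: cosine_decr; lra. Qed.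
Lemma cosine_lt_half x : x <= N -> N < 3 * x -> co x < 2^-1.
Proof. by move=> x0 xN; rewrite -cosine_third; apply: cosine_decr; lra. Qed.

Let c1E : co 1 ^+ 2 = 1 - s 1 ^+ 2. Proof. exact: cosine2_sine2. Qed.
Let sum2 : 2 = 1 + 1 :> R. Proof. by []. Qed.
Let sum3 : 3 = 2 + 1 :> R. Proof. by ring. Qed.
Let sum4 : 4 = 3 + 1 :> R. Proof. by ring. Qed.
Let sum5 : 5 = 4 + 1 :> R. Proof. by ring. Qed.
Let sum6 : 6 = 5 + 1 :> R. Proof. by ring. Qed.
Let sum7 : 7 = 6 + 1 :> R. Proof. by ring. Qed.
Let sum8 : 8 = 7 + 1 :> R. Proof. by ring. Qed.
Let sum9 : 9 = 8 + 1 :> R. Proof. by ring. Qed.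

(** The factorisations below reduce the sign of [crossing_height] at small
    indices to that of [cosine] at small multiples of the unit, compared with 0
    or with 1/2. *)
Lemma heightE i j a b d : i - 1 = a -> j - 2 = b -> i + j = d ->
  crossing_height i j = s a * s b - s 1 * s d.
Proof. by rewrite /crossing_height => -> -> ->. Qed.

Ltac expand := rewrite ?(sum9, sum8, sum7, sum6, sum5, sum4, sum3, sum2) !(sineD, cosineD); ring: c1E.

Lemma height23 i j : i = 2 -> j = 3 -> crossing_height i j = - (2 * s 1 * s 2 * co 3).
Proof. by move=> -> ->; rewrite (@heightE _ _ 1 1 5); [expand|lra..]. Qed.

Lemma height24 i j : i + j = 6 -> i = 2 \/ i = 3 -> crossing_height i j = - (2 * s 1 * s 2 * co 4).
Proof.
move=> ij ih; have -> : crossing_height i j = s 1 * s 2 - s 1 * s 6; last by expand.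
have -> : j = 6 - i by lra.
by case: ih => ->; [rewrite (@heightE _ _ 1 2 6)|rewrite (@heightE _ _ 2 1 6)] => //; try lra; ring.
Qed.

Lemma height43 i j : i = 4 -> j = 3 -> crossing_height i j = - (2 * s 1 * s 2 * co 5).
Proof. by move=> -> ->; rewrite (@heightE _ _ 3 1 7); [expand|lra..]. Qed.

Lemma height34 i j : i = 3 -> j = 4 ->
  crossing_height i j = s 1 ^+ 2 * (1 - 2 * (co 6 + co 4)).
Proof. by move=> -> ->; rewrite (@heightE _ _ 2 2 7); [expand|lra..]. Qed.

Lemma height44 i j : i + j = 8 -> i = 3 \/ i = 4 -> crossing_height i j = s 1 * s 2 * (1 - 2 * co 6).
Proof.
move=> ij ih; have -> : crossing_height i j = s 2 * s 3 - s 1 * s 8; last by expand.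
have -> : j = 8 - i by lra.
by case: ih => ->; [rewrite (@heightE _ _ 2 3 8)|rewrite (@heightE _ _ 3 2 8)] => //; try lra; ring.
Qed.

Lemma height45 i j : i = 4 -> j = 5 -> crossing_height i j = 4 * s 1 * s 2 * s 3 * s 4.
Proof.
move=> -> ->; rewrite (@heightE _ _ 3 3 9); [|lra..].
have e3 : s 3 = 3 * s 1 - 4 * s 1 ^+ 3 by expand.
have e24 : s 2 * s 4 = s 3 ^+ 2 - s 1 ^+ 2 by expand.
have e9 : s 9 = 3 * s 3 - 4 * s 3 ^+ 3.
  have -> : 9 = 3 + 3 + 3 :> R by ring.
  by rewrite (sineD (3 + 3)) (sineD 3) (cosineD 3); ring: (cosine2_sine2 3).
have -> : 4 * s 1 * s 2 * s 3 * s 4 = 4 * s 1 * s 3 * (s 2 * s 4) by ring.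
rewrite e9 e24; apply/eqP; rewrite -subr_eq0; apply/eqP.
transitivity (s 3 * (s 3 - (3 * s 1 - 4 * s 1 ^+ 3))); first by ring.
by rewrite -e3 subrr mulr0.
Qed.

Lemma height_neg i j : i = 1 \/ j = 2 -> 0 < i + j < N -> crossing_height i j < 0.
Proof.
move=> ij ijN; rewrite /crossing_height; have -> : s (i - 1) * s (j - 2) = 0.
  by case: ij => ->; rewrite subrr sine0 ?mul0r ?mulr0.
by rewrite add0r oppr_lt0 mulr_gt0 ?sine1_gt0 ?sine_gt0.
Qed.

(** The pencils start at (i, j) = (1, 2) for [n = 5], (2, 2) for 7, (2, 3) for
    9 to 11, (3, 3) for 13 to 17 and (3, 4) from 19 on.  The last two cases are
    separated by the sign of 1 - 2 cos(6 pi/n), which is zero for [n = 18]. *)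
Lemma pentagon_exists : n \notin [:: 3; 4; 6; 8; 12; 18]%N -> exists F, k_face 5 Dn F.
Proof.
move=> nn; have N3 := N_ge3; have p1 := sine1_gt0; have p2 := sine2_gt0.
have int_nat k : k%:R \is a @Num.int R by exact: natr_int.
have p12 : 0 < s 1 * s 2 by rewrite mulr_gt0.
have /orP[n19|n19] : (19 <= n)%N || (n < 19)%N by rewrite leqNgt orNb.
  have N19 : 19 <= N by rewrite ler_nat.
  have c6 : 2^-1 < co 6 by apply: cosine_gt_half; lra.
  have c4 : 2^-1 < co 4 by apply: cosine_gt_half; lra.
  have p3 : 0 < s 3 by apply: sine_gt0; apply/andP; split; lra.
  have p4 : 0 < s 4 by apply: sine_gt0; apply/andP; split; lra.
  apply: (@pencil_pentagon 3 4) => //; try lra.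
  - by rewrite height34//; rewrite pmulr_rlt0 ?exprn_gt0//; lra.
  - by rewrite height44; [nra|lra|right; lra].
  - by rewrite height44; [nra|lra|left; lra].
  - by rewrite height45; [rewrite !mulr_gt0|lra..].
have /orP[n13|n13] : (13 <= n)%N || (n < 13)%N by rewrite leqNgt orNb.
  have N13 : 13 <= N by rewrite ler_nat.
  have N17 : N <= 17 by rewrite ler_nat; move: nn n19; rewrite !inE; lia.
  have c6 : co 6 < 2^-1 by apply: cosine_lt_half; lra.
  have c6' : 0 < co 6 by apply: cosine_gt0; lra.
  have c5 : 0 < co 5 by apply: cosine_gt0; lra.
  have c4 : 2^-1 < co 4 by apply: cosine_gt_half; lra.
  apply: (@pencil_pentagon 3 3) => //; try lra.
  - by rewrite height24; [have ? : 0 < co 4 by lra|lra|right; lra]; nra.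
  - by rewrite height43; [nra|lra..].
  - by rewrite height34; [rewrite pmulr_rlt0 ?exprn_gt0//; lra|lra..].
  - by rewrite height44; [nra|lra|right; lra].
have /orP[n9|n9] : (9 <= n)%N || (n < 9)%N by rewrite leqNgt orNb.
  have N9 : 9 <= N by rewrite ler_nat.
  have N11 : N <= 11 by rewrite ler_nat; move: nn n13; rewrite !inE; lia.
  have c6 : co 6 < 0 by apply: cosine_lt0; lra.
  have c4 : co 4 < 2^-1 by apply: cosine_lt_half; lra.
  have c4' : 0 < co 4 by apply: cosine_gt0; lra.
  have c3 : 0 < co 3 by apply: cosine_gt0; lra.
  apply: (@pencil_pentagon 2 3) => //; try lra.
  - by rewrite height23; [nra|lra..].
  - by rewrite height24; [nra|lra|right; lra].
  - by rewrite height24; [nra|lra|left; lra].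
  - by rewrite height34; [rewrite pmulr_rgt0 ?exprn_gt0//; lra|lra..].
have /orP[n7|n7] : (7 <= n)%N || (n < 7)%N by rewrite leqNgt orNb.
  have N7 : N = 7 by congr _%:R; move: nn n9; rewrite !inE; lia.
  have c4 : co 4 < 0 by apply: cosine_lt0; lra.
  have c3 : 0 < co 3 by apply: cosine_gt0; lra.
  apply: (@pencil_pentagon 2 2) => //; try lra.
  - by apply: height_neg; [right|rewrite N7; apply/andP; split; lra].
  - by apply: height_neg; [right|rewrite N7; apply/andP; split; lra].
  - by rewrite height23; [nra|lra..].
  - by rewrite height24; [nra|lra|right; lra].
have N5 : N = 5 by congr _%:R; move: nn n7 n_ge3; rewrite !inE; lia.
have c3 : co 3 < 0 by apply: cosine_lt0; lra.
apply: (@pencil_pentagon 1 2) => //; try lra.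
- by apply: height_neg; [right|rewrite N5; apply/andP; split; lra].
- by apply: height_neg; [right|rewrite N5; apply/andP; split; lra].
- by apply: height_neg; [left|rewrite N5; apply/andP; split; lra].
- by rewrite height23; [nra|lra..].
Qed.
End RegularPolygon.

(** * Integer arithmetic and rigorous decimals *)
Section IntegerReals.
Variable R : realType.
(** Locked, since unfolding the embedding of a large integer during unification
    would produce unary numerals. *)
Definition zR : Z -> R := locked (fun m => (int_of_Z m)%:~R).
Lemma zRdef m : zR m = (int_of_Z m)%:~R. Proof. by rewrite /zR -lock. Qed.
Lemma zR0 : zR 0%BZ = 0. Proof. by rewrite zRdef. Qed.
Lemma zRD a b : zR (a + b)%BZ = zR a + zR b.
Proof. by rewrite !zRdef -intrD; congr (_%:~R); lia. Qed.
Lemma zRM a b : zR (a * b)%BZ = zR a * zR b.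
Proof. by rewrite !zRdef -intrM; congr (_%:~R); lia. Qed.
Lemma zRN a : zR (- a)%BZ = - zR a.
Proof. by rewrite !zRdef -mulrNz; congr (_%:~R); lia. Qed.
Lemma zRB a b : zR (a - b)%BZ = zR a - zR b.
Proof. by rewrite !zRdef -intrB; congr (_%:~R); lia. Qed.
Lemma zR_int a : zR a \is a Num.int. Proof. by rewrite zRdef intr_int. Qed.
Lemma zR_le a b : (a <=? b)%BZ -> zR a <= zR b.
Proof. by move=> ab; rewrite !zRdef ler_int; lia. Qed.
Lemma zR_lt a b : (a <? b)%BZ -> zR a < zR b.
Proof. by move=> ab; rewrite !zRdef ltr_int; lia. Qed.
Lemma zRE (k : nat) : zR (Z.of_nat k) = k%:R.
Proof. by rewrite zRdef pmulrn; congr (_%:~R); lia. Qed.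
Lemma int_zR (x : R) : x \is a Num.int -> exists m, x = zR m.
Proof. by move=> /intrP[k ->]; exists (Z_of_int k); rewrite zRdef; congr (_%:~R); lia. Qed.

Definition scale : Z := 100000000%BZ.
(** An enclosure of [x] by integer multiples of [10 ^ -8], so that interval
    arithmetic is checked by computing with binary integers. *)
Definition within (x : R) (a b : Z) := zR a <= zR scale * x <= zR b.
Let S := zR scale.
Let S_gt0 : 0 < S. Proof. by rewrite -zR0; exact: zR_lt. Qed.

Lemma within_mul x y a b c d e f : within x a b -> within y c d ->
  [&& 0 <=? a, 0 <=? c, scale * e <=? a * c & b * d <=? scale * f]%BZ ->
  within (x * y) e f.
Proof.
move=> /andP[ax xb] /andP[cy yd] /and4P[/zR_le a0 /zR_le c0 /zR_le h1 /zR_le h2].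
rewrite !zRM -/S in h1 h2; rewrite zR0 in a0 c0.
have l := ler_pM a0 c0 ax cy; rewrite -/S in l ax cy xb yd.
have u := ler_pM (le_trans a0 ax) (le_trans c0 cy) xb yd.
have e2 : S * (S * (x * y)) = (S * x) * (S * y) by ring.
apply/andP; split; rewrite -(ler_pM2l S_gt0) -/S e2.
  exact: le_trans h1 l.
exact: le_trans u h2.
Qed.

Lemma within_root x a b e f : within (x * x) a b -> 0 <= x ->
  [&& 0 <=? e, 0 <=? f, e * e <=? scale * a & scale * b <=? f * f]%BZ ->
  within x e f.
Proof.
move=> /andP[ax xb] x0 /and4P[/zR_le e0 /zR_le f0 /zR_le h1 /zR_le h2].
rewrite !zRM -/S in h1 h2 ax xb *; rewrite zR0 in e0 f0.
have Sx0 : 0 <= S * x by rewrite mulr_ge0 // ltW.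
have l : zR e * zR e <= (S * x) * (S * x).
  apply: le_trans h1 _; rewrite -mulrA ler_pM2l// mulrCA; exact: ax.
have u : (S * x) * (S * x) <= zR f * zR f.
  apply: le_trans h2; rewrite -mulrA ler_pM2l// mulrCA; exact: xb.
by apply/andP; split; rewrite -ler_sqr ?nnegrE// !expr2.
Qed.

Lemma within_1B2 x a b : within x a b -> within (1 - 2 * x) (scale - 2 * b)%BZ (scale - 2 * a)%BZ.
Proof.
move=> /andP[ax xb]; rewrite /within !zRB !zRM (zRE 2) -/S.
by apply/andP; split; rewrite -/S in ax xb; lra.
Qed.

Lemma within_1B x a b : within x a b -> within (1 - x) (scale - b)%BZ (scale - a)%BZ.
Proof.
move=> /andP[ax xb]; rewrite /within !zRB -/S.
by apply/andP; split; rewrite -/S in ax xb; lra.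
Qed.

Lemma within_half : within 2^-1 50000000 50000000.
Proof.
by rewrite /within (_ : scale = (2 * 50000000)%BZ)// zRM (zRE 2); apply/andP; split; lra.
Qed.

Lemma within_zR x a : zR scale * x = zR a -> within x a a.
Proof. by rewrite /within => ->; rewrite lexx. Qed.

Lemma within_2 x a b : within x a b -> within (2 * x) (2 * a)%BZ (2 * b)%BZ.
Proof.
move=> /andP[ax xb]; rewrite /within !zRM (zRE 2) -/S.
by apply/andP; split; rewrite -/S in ax xb; lra.
Qed.

Lemma within_2B1 x a b : within x a b -> within (2 * x - 1) (2 * a - scale)%BZ (2 * b - scale)%BZ.
Proof.
move=> /andP[ax xb]; rewrite /within !zRB !zRM (zRE 2) -/S.
by apply/andP; split; rewrite -/S in ax xb; lra.
Qed.

Lemma withinW x a b e f : within x a b -> (e <=? a)%BZ && (b <=? f)%BZ -> within x e f.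
Proof.
by move=> /andP[ax xb] /andP[/zR_le ea /zR_le bf]; apply/andP; split; [apply: le_trans ea ax|apply: le_trans xb bf].
Qed.

(** The cubic decreases on [0, 1/2], so its root there is located by the signs
    at the two bounds. *)
Lemma within_cubic x a b : 0 <= x -> x <= 1 / 2 -> 8 * x ^+ 3 - 6 * x + 1 = 0 ->
  [&& 0 <=? a, a <=? b, 2 * b <=? scale,
      0 <=? 8 * (a * a * a) - 6 * (a * (scale * scale)) + scale * scale * scale
    & 8 * (b * b * b) - 6 * (b * (scale * scale)) + scale * scale * scale <=? 0]%BZ ->
  within x a b.
Proof.
move=> x0 x1 xE /and5P[/zR_le a0 /zR_le ab /zR_le b1 /zR_le ga /zR_le gb].
move: ga gb b1; rewrite !(zRD, zRB, zRM) (zRE 8) (zRE 6) (zRE 2) zR0.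
rewrite zR0 in a0; rewrite /within -/S.
move: (zR a) (zR b) a0 ab => u v u0 uv gu gv v1.
have key y : 8 * (y * y * y) - 6 * (y * (S * S)) + S * S * S =
  (S * x - y) * (6 * (S * S) - 8 * ((S * x) ^+ 2 + S * x * y + y ^+ 2)).
  transitivity (8 * (y * y * y) - 6 * (y * (S * S)) + S * S * S -
     S ^+ 3 * (8 * x ^+ 3 - 6 * x + 1)); last by ring.
  by rewrite xE; ring.
have neg y : 0 <= y -> 2 * y <= S -> (y != S * x) -> 0 < 6 * (S * S) - 8 * ((S * x) ^+ 2 + S * x * y + y ^+ 2).
  move=> y0 y1 yx; have : S * x <= S / 2 by rewrite ler_pM2l//; lra.
  have : 0 <= S * x by rewrite mulr_ge0 // ltW.
  move: (S * x) yx => w yw w0 w1; have [h|h] := ltP y w; first by nra.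
  have : w < y by rewrite lt_neqAle eq_sym yw.
  by nra.
rewrite !key in gu gv.
apply/andP; split; rewrite leNgt; apply/negP => h.
  have := neg u u0 ltac:(lra) ltac:(rewrite gt_eqF//); by nra.
by have := neg v ltac:(lra) v1 ltac:(rewrite lt_eqF//); nra.
Qed.
End IntegerReals.

(** * The regular 18-gon *)
Section Eighteen.
Variables (R : realType) (n : nat).
Hypothesis n18 : n = 18%N.
Local Notation N := (n%:R : R).
Local Notation s := (@sine R n).
Local Notation co := (@cosine R n).
Local Notation zR := (@zR R).
Local Notation within := (@within R).

Let N18 : N = 18. Proof. by rewrite n18. Qed.
Let n_ge3 : (2 < n)%N. Proof. by rewrite n18. Qed.

(** [10 ^ 5] times the sines of the multiples of ten degrees, rounded. *)
Definition sin_table : seq Z :=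
  [:: 0; 17365; 34202; 50000; 64279; 76604; 86603; 93969; 98481; 100000]%BZ.
Definition sin_digits (m : Z) : Z :=
  let k := Z.abs m in
  let d := nth 0%BZ sin_table (Z.to_nat (if (k <=? 9)%BZ then k else (18 - k)%BZ)) in
  if (0 <=? m)%BZ then d else (- d)%BZ.

Lemma sine_reflect x : s (18 - x) = s x. Proof. by rewrite -N18 sine_nB. Qed.
Lemma sine9 : s 9 = 1.
Proof.
rewrite /sine N18; have -> : (9 : R) * (pi / 18) = pi / 2 by field.
exact: sin_pihalf.
Qed.
Lemma cosine_sine x : co x = s (9 - x).
Proof.
have c9 : co 9 = 0.
  have -> : 9 = N / 2 by rewrite N18; lra.
  exact: cosine_half.
by rewrite sineB sine9 c9; ring.
Qed.

(** The triple angle formula makes the sine of ten degrees a root of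
    8x^3 - 6x + 1; the other sines follow by doubling angles and by
    cos x = sin (90 - x). *)
Lemma sin_values (k : nat) (d := (1000 * nth 0 sin_table k)%BZ) : (k <= 9)%N ->
  within (s k%:R) (d - 1000)%BZ (d + 1000)%BZ.
Proof.
have pos x : 0 < x < 18 -> 0 < s x by move=> xN; apply: sine_gt0; rewrite ?N18.
have p1 : 0 < s 1 by apply: pos; apply/andP; split; lra.
have p8 : 0 < s 8 by apply: pos; apply/andP; split; lra.
have p6 : 0 < s 6 by apply: pos; apply/andP; split; lra.
have s3 : s 3 = 2^-1.
  have -> : 3 = 9 - N / 3 :> R by rewrite N18; lra.
  by rewrite -cosine_sine cosine_third.
have c1 : co 1 = s 8 by rewrite cosine_sine; congr sine; lra.
have c2 : co 2 = s 7 by rewrite cosine_sine; congr sine; lra.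
have c4 : co 4 = s 5 by rewrite cosine_sine; congr sine; lra.
have c3 : co 3 = s 6 by rewrite cosine_sine; congr sine; lra.
have d2 : 2 = 1 + 1 :> R by lra.
have d3 : 3 = 1 + 1 + 1 :> R by lra.
have d4 : 4 = 2 + 2 :> R by lra.
have s8q : s 8 * s 8 = 1 - s 1 * s 1 by rewrite -c1 -!expr2 cosine2_sine2.
have s6q : s 6 * s 6 = 1 - s 3 * s 3 by rewrite -c3 -!expr2 cosine2_sine2.
have s2E : s 2 = 2 * (s 1 * s 8) by rewrite d2 sineD c1; ring.
have s7E : s 7 = 1 - 2 * (s 1 * s 1).
  by rewrite -c2 d2 cosineD; have := cosine2_sine2 n (1 : R); rewrite expr2 => ->; ring.
have s4E : s 4 = 2 * (s 2 * s 7) by rewrite d4 sineD c2; ring.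
have s5E : s 5 = 2 * (s 7 * s 7) - 1.
  by rewrite -c4 d4 cosineD -c2; have := cosine2_sine2 n (2 : R); rewrite !expr2 => h; lra.
have cubic : 8 * (s 1 * s 1 * s 1) - 6 * s 1 + 1 = 0.
  have : s (1 + 1 + 1) = 2^-1 by rewrite -d3.
  rewrite !sineD !cosineD c1; nra.
have s1_half : s 1 < 1 / 2.
  have : s 1 < s 3.
    have h x : s x = co (9 - x) by rewrite cosine_sine; congr sine; lra.
    by rewrite !h; apply: (cosine_decr n_ge3); have := N18 => ?; lra.
  by rewrite s3; lra.
have b1 : within (s 1) 17364817 17364818.
  apply: within_cubic => //; [exact: ltW|exact: ltW|].
  by rewrite -{}cubic; ring.
have b11 : within (s 1 * s 1) 3015368 3015370 by exact: (within_mul b1 b1).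
have b7 : within (s 7) 93969260 93969264 by rewrite s7E; exact: withinW (within_1B2 b11) _.
have b8 : within (s 8) 98480774 98480777.
  have := within_1B b11; rewrite -s8q => h; apply: within_root h _ _ => //; exact: ltW.
have b3 : within (s 3) 50000000 50000000 by rewrite s3; exact: within_half.
have b6 : within (s 6) 86602539 86602541.
  have b33 : within (s 3 * s 3) 25000000 25000000 by exact: (within_mul b3 b3).
  have := within_1B b33; rewrite -s6q => h; apply: within_root h _ _ => //; exact: ltW.
have b2 : within (s 2) 34202010 34202018.
  have b18 : within (s 1 * s 8) 17101005 17101009 by exact: (within_mul b1 b8).
  by rewrite s2E; exact: withinW (within_2 b18) _.
have b4 : within (s 4) 64278750 64278774.
  have b27 : within (s 2 * s 7) 32139375 32139386 by exact: (within_mul b2 b7).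
  by rewrite s4E; exact: withinW (within_2 b27) _.
have b5 : within (s 5) 76604432 76604456.
  have b77 : within (s 7 * s 7) 88302218 88302227 by exact: (within_mul b7 b7).
  by rewrite s5E; exact: withinW (within_2B1 b77) _.
have b9 : within (s 9) 100000000 100000000.
  by rewrite sine9; apply: within_zR; rewrite mulr1.
case: k @d => [|[|[|[|[|[|[|[|[|[|k]]]]]]]]]] // d _; rewrite ?mulr0n ?mulr1n.
- have -> : s 0 = 0 by exact: sine0.
  by apply: (@withinW _ _ 0%BZ 0%BZ) => //; apply: within_zR; rewrite mulr0 zR0.
- exact: withinW b1 _.
- exact: withinW b2 _.
- exact: withinW b3 _.
- exact: withinW b4 _.
- exact: withinW b5 _.
- exact: withinW b6 _.
- exact: withinW b7 _.
- exact: withinW b8 _.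
- exact: withinW b9 _.
Qed.

Definition E5 : Z := 100000%BZ.
Local Notation E := (zR E5).

Let E_gt0 : 0 < E. Proof. by rewrite -zR0; exact: zR_lt. Qed.

Definition small (m : Z) := ((-18 <=? m) && (m <=? 18))%BZ.

Lemma sin_digits_nat (k : nat) : (k <= 18)%N -> `|E * s k%:R - zR (sin_digits (Z.of_nat k))| <= 1.
Proof.
have base j : (j <= 9)%N -> `|E * s j%:R - zR (nth 0%BZ sin_table j)| <= 1.
  move=> /sin_values; rewrite /sine /within.
  have -> : scale = (1000 * E5)%BZ by [].
  have e1 : 0 < zR 1000%BZ by rewrite -zR0; exact: zR_lt.
  rewrite zRD zRB !zRM; move: (zR 1000) e1 => K K0 h; rewrite ler_norml; move: h.
  move: (sin _) => x /andP[h1 h2]; apply/andP; split; rewrite -(ler_pM2l K0); nra.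
move=> k18; rewrite /sin_digits.
have -> : (0 <=? Z.of_nat k)%BZ by lia.
have -> : Z.abs (Z.of_nat k) = Z.of_nat k by lia.
case: Z.leb_spec => h.
  rewrite Nat2Z.id; apply: base; lia.
have -> : Z.to_nat (18 - Z.of_nat k)%BZ = (18 - k)%N by lia.
have -> : k%:R = 18 - (18 - k)%N%:R :> R by rewrite natrB //; ring.
rewrite sine_reflect; apply: base; lia.
Qed.

Lemma sin_digitsP m : small m -> `|E * s (zR m) - zR (sin_digits m)| <= 1.
Proof.
rewrite /small => /andP[m1 m2].
have [m0|m0] := leP 0%R m.
  have -> : m = Z.of_nat (Z.to_nat m) by lia.
  rewrite zRE; apply: sin_digits_nat; lia.
have -> : m = (- Z.of_nat (Z.to_nat (- m)))%BZ by lia.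
set k := Z.to_nat _; have k0 : (0 < k)%N by lia.
have -> : sin_digits (- Z.of_nat k) = (- sin_digits (Z.of_nat k))%BZ.
  have /allP/(_ k) : all (fun k => sin_digits (- Z.of_nat k) =? - sin_digits (Z.of_nat k))%BZ (iota 1 18) by vm_compute.
  by rewrite mem_iota => h; apply/Z.eqb_eq/h; lia.
rewrite !zRN zRE sineN mulrN -opprD normrN; apply: sin_digits_nat; lia.
Qed.

Lemma sin_digits_le m : small m -> `|zR (sin_digits m)| <= E.
Proof.
move=> ms; have {ms} : (- E5 <=? sin_digits m)%BZ && (sin_digits m <=? E5)%BZ.
  have : all (fun k => let d := sin_digits (Z.of_nat k - 18)%BZ in (- E5 <=? d)%BZ && (d <=? E5)%BZ) (iota 0 37) by vm_compute.
  move=> /allP/(_ (Z.to_nat (m + 18)%BZ)).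
  rewrite mem_iota; have -> : (Z.of_nat (Z.to_nat (m + 18)) - 18)%BZ = m by move: ms; rewrite /small; lia.
  by apply; move: ms; rewrite /small; lia.
by move=> /andP[/(@zR_le R _ _) h1 /(@zR_le R _ _) h2]; rewrite ler_norml -zRN h1.
Qed.

Lemma mul_error (x y X Y K L d e : R) : `|x - X| <= d -> `|y - Y| <= e ->
  `|x| <= K -> `|Y| <= L -> `|x * y - X * Y| <= K * e + d * L.
Proof.
move=> h1 h2 h3 h4; have -> : x * y - X * Y = x * (y - Y) + (x - X) * Y by ring.
by rewrite (le_trans (ler_normD _ _))// lerD// normrM ler_pM.
Qed.

Lemma E_s_le x : `|E * s x| <= E.
Proof.
rewrite normrM (gtr0_norm E_gt0) ler_piMr ?(ltW E_gt0)//.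
by rewrite /sine ler_norml sin_geN1 sin_le1.
Qed.

(** Replacing the factors of a product of sines one by one by their table
    values costs one unit, scaled by the other factors, for each of them. *)
Lemma sin_digits2 m k : small m -> small k ->
  `|E ^+ 2 * (s (zR m) * s (zR k)) - zR (sin_digits m * sin_digits k)%BZ| <= 2 * E.
Proof.
move=> ms ks.
have := mul_error (sin_digitsP ms) (sin_digitsP ks) (E_s_le _) (sin_digits_le ks).
rewrite zRM; have -> : E * 1 + 1 * E = 2 * E by ring.
by rewrite expr2 mulrACA.
Qed.

Lemma sin_digits4 m k p q : small m -> small k -> small p -> small q ->
  `|E ^+ 4 * (s (zR m) * s (zR k) * (s (zR p) * s (zR q)))
    - zR (sin_digits m * sin_digits k * (sin_digits p * sin_digits q))%BZ| <= 4 * E ^+ 3.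
Proof.
move=> ms ks ps qs.
have h1 : `|E ^+ 2 * (s (zR m) * s (zR k))| <= E ^+ 2.
  have -> : E ^+ 2 * (s (zR m) * s (zR k)) = (E * s (zR m)) * (E * s (zR k)) by ring.
  by rewrite normrM expr2 ler_pM ?E_s_le.
have h2 : `|zR (sin_digits p * sin_digits q)%BZ| <= E ^+ 2.
  by rewrite zRM normrM expr2 ler_pM ?sin_digits_le.
have := mul_error (sin_digits2 ms ks) (sin_digits2 ps qs) h1 h2.
rewrite -zRM.
have -> : E ^+ 2 * (2 * E) + 2 * E * E ^+ 2 = 4 * E ^+ 3 by ring.
by rewrite mulrACA -exprD.
Qed.

Variables (c : R * R) (r theta : R).
Hypothesis r_gt0 : 0 < r.
Local Notation pt := (R * R)%type.
Local Notation P := (@ngon R n c r theta).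
Local Notation Dn := (@ngon_drawing R n c r theta).
Definition zchord (l : Z * Z) : pt -> R := chord n c r theta (zR l.1) (zR l.2).
Definition zmeet (l l' : Z * Z) : pt := meet n c r theta (zR l.1) (zR l.2) (zR l'.1) (zR l'.2).

Definition crosses (l l' : Z * Z) : bool :=
  let: (a, b) := l in let: (u, v) := l' in
  let d x y := sin_digits (x - y)%BZ in
  [&& small (a - u), small (a - v), small (b - u), small (b - v),
      2 * E5 <? d a u * d a v & d b u * d b v <? - (2 * E5)]%BZ.

(** The numerator of [chord_meet] for line [m] at the crossing of [l] and [l'],
    read from the table. *)
Definition numerator (l l' m : Z * Z) : Z :=
  let: (a, b) := l in let: (u, v) := l' in let: (e, g) := m in
  let d x y := sin_digits (x - y)%BZ in
  (d a u * d a v * (d b e * d b g) - d b u * d b v * (d a e * d a g))%BZ.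

Definition smalls (l m : Z * Z) : bool :=
  let: (a, b) := l in let: (e, g) := m in
  [&& small (a - e), small (a - g), small (b - e) & small (b - g)]%BZ.

(** Twice the error of [sin_digits4], as [numerator] has two such terms. *)
Definition threshold : Z := (8 * E5 * E5 * E5)%BZ.

Lemma crossesP l l' : crosses l l' ->
  zchord l' (P (zR l.2)) < 0 /\ 0 < zchord l' (P (zR l.1)).
Proof.
case: l l' => [a b] [u v] /and5P[s1 s2 s3 s4 /andP[h1 h2]] /=.
have E2 : 0 < E ^+ 2 by rewrite exprn_gt0.
rewrite /zchord /= !chord_ngon // -!zRB; split.
  have := sin_digits2 s3 s4; have := @zR_lt R _ _ h2; rewrite zRN (zRM R 2) (zRE R 2).
  rewrite ler_norml => h /andP[_ h']; rewrite -(pmulr_rlt0 _ E2); lra.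
have := sin_digits2 s1 s2; have := @zR_lt R _ _ h1; rewrite (zRM R 2) (zRE R 2).
rewrite ler_norml => h /andP[h' _]; rewrite -(pmulr_rgt0 _ E2); lra.
Qed.

Lemma numerator_sign l l' m : crosses l l' -> smalls l m ->
  ((threshold <? numerator l l' m)%BZ -> 0 < zchord m (zmeet l l')) /\
  ((numerator l l' m <? - threshold)%BZ -> zchord m (zmeet l l') < 0).
Proof.
move=> cr sm; have [h1 h2] := crossesP cr.
have [d d0] := chord_meet r_gt0 (zR m.1) (zR m.2) h1 h2.
rewrite /zchord /zmeet => ->.
rewrite pmulr_rgt0// pmulr_rlt0//.
have th : zR threshold = 8 * E ^+ 3 by rewrite /threshold !zRM (zRE R 8); ring.
move: (threshold) th => T th; move: cr sm {h1 h2}; case: l l' m => [a b] [u v] [e g].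
move=> /and5P[s1 s2 s3 s4 _] /and4P[s5 s6 s7 s8]; rewrite /= -!zRB.
have E4 : 0 < E ^+ 4 by rewrite exprn_gt0.
have := sin_digits4 s1 s2 s7 s8; have := sin_digits4 s3 s4 s5 s6.
rewrite !ler_norml => /andP[e1 e2] /andP[e3 e4].
split => /(@zR_lt R _ _); rewrite ?zRN th zRB => h.
  rewrite -(pmulr_rgt0 _ E4); lra.
rewrite -(pmulr_rlt0 _ E4); lra.
Qed.

(** A line is paired with the side, positive or negative, on which the pentagon
    lies.  Each corner is the crossing of two chords, where the first one is
    oriented so that its first end is on the positive side of the second. *)
Definition edges18 : seq (bool * (Z * Z)) :=
  [:: (true, (2, 6)); (false, (-4, 4)); (false, (0, 5)); (false, (3, 9)); (true, (-3, 4))]%BZ.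
Definition corners18 : seq ((Z * Z) * (Z * Z)) :=
  [:: ((6, 2), (-3, 4)); ((6, 2), (-4, 4)); ((5, 0), (-4, 4)); ((0, 5), (3, 9)); ((9, 3), (-3, 4))]%BZ.
(** Chords that cross the lines of two edges near a corner are not excluded by
    any single edge; they are excluded by these four chord lines, which do not
    enter the pentagon either. *)
Definition separators18 : seq (bool * (Z * Z)) :=
  [:: (true, (3, 8)); (false, (2, 7)); (true, (1, 5)); (false, (1, 6))]%BZ.

Definition sided (l : bool * (Z * Z)) : pt -> R :=
  if l.1 then zchord l.2 else fun z => - zchord l.2 z.
Definition positive (l : bool * (Z * Z)) (v : (Z * Z) * (Z * Z)) : bool :=
  let x := numerator v.1 v.2 l.2 in
  smalls v.1 l.2 && (if l.1 then threshold <? x else x <? - threshold)%BZ.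

Lemma positiveP l v : crosses v.1 v.2 -> positive l v -> 0 < sided l (zmeet v.1 v.2).
Proof.
move=> cr /andP[sm]; have [h1 h2] := numerator_sign cr sm.
by rewrite /sided; case: (l.1) => [/h1|/h2]; rewrite ?oppr_gt0.
Qed.

Lemma crosses18 : all (fun v => crosses v.1 v.2) corners18.
Proof. by vm_compute. Qed.

Let v0 := ((0, 0), (0, 0))%BZ.
Let e0 := (true, (0, 0))%BZ.
Definition corner18 (i : nat) : pt :=
  let v := nth v0 corners18 i in zmeet v.1 v.2.

Lemma positive_edge (i j : nat) : (i < 5)%N -> (j < 5)%N -> j != i -> j != (i.+1 %% 5)%N ->
  0 < sided (nth e0 edges18 i) (corner18 j).
Proof.
move=> i5 j5 ji jS; apply: positiveP.
  by apply: (allP crosses18); rewrite mem_nth.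
move: i j i5 j5 ji jS.
by move=> [|[|[|[|[|i]]]]] [|[|[|[|[|j]]]]] //= _ _ _ _; vm_compute.
Qed.

Lemma zchord_meet_l v l : crosses v.1 v.2 -> l = v.1 \/ l = (v.1.2, v.1.1) ->
  zchord l (zmeet v.1 v.2) = 0.
Proof.
move=> cr; have [h1 h2] := crossesP cr => lv.
have [d d0] := chord_meet r_gt0 (zR l.1) (zR l.2) h1 h2.
rewrite /zchord /zmeet => ->.
by case: lv => -> /=; rewrite !subrr sine0; ring.
Qed.

Lemma zchord_meet_r v : crosses v.1 v.2 -> zchord v.2 (zmeet v.1 v.2) = 0.
Proof.
move=> cr; have [h1 h2] := crossesP cr.
exact: chord_meet_other.
Qed.

(** The chord (3, 8) passes exactly through a corner, where no approximation
    could decide on which side it leaves the pentagon; the concurrency amounts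
    to sin 10 sin 80 = sin 20 sin 30 (in degrees). *)
Lemma concurrent18 : zchord (3, 8)%BZ (corner18 1) = 0.
Proof.
have [h1 h2] := crossesP (l := (6, 2)%BZ) (l' := (-4, 4)%BZ) ltac:(by vm_compute).
have [d d0] := chord_meet r_gt0 (zR 3) (zR 8) h1 h2.
rewrite /corner18 /zmeet /zchord => ->; rewrite /= -!zRB /=.
have n1 k : zR (- Z.of_nat k)%BZ = - k%:R by rewrite zRN zRE.
rewrite (zRE R 10) (zRE R 2) (n1 1%N) (n1 6%N) (zRE R 6) (n1 2%N) (zRE R 3) mulr1n.
have s10 : s 10 = s 8 by rewrite -sine_reflect; congr sine; lra.
have s3 : s 3 = 2^-1.
  have -> : 3 = 9 - N / 3 :> R by rewrite N18; lra.
  by rewrite -cosine_sine cosine_third.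
have s2 : s 2 = 2 * (s 1 * s 8).
  have -> : 2 = 1 + 1 :> R by lra.
  by rewrite sineD cosine_sine (_ : 9 - 1 = 8 :> R); [ring|lra].
rewrite !sineN s10 s3; transitivity (d * s 2 * s 6 * (s 8 * s 1 - s 2 / 2)); first by field.
by rewrite s2; field.
Qed.

Lemma sided_affine l : affine (sided l).
Proof.
rewrite /sided; case: (l.1); first exact: chord_affine.
by apply: affineN; exact: chord_affine.
Qed.

Lemma sided_eq0 l z : zchord l.2 z = 0 -> sided l z = 0.
Proof. by rewrite /sided; case: (l.1) => // ->; rewrite oppr0. Qed.

Lemma polygon18 : polygon (fun i : 'I_5 => sided (nth e0 edges18 i)) (fun i : 'I_5 => corner18 i).
Proof.
have cr (i : nat) : (i < 5)%N -> crosses (nth v0 corners18 i).1 (nth v0 corners18 i).2.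
  by move=> i5; apply: (allP crosses18); rewrite mem_nth.
split => //.
- by move=> i; exact: sided_affine.
- by move=> [[|[|[|[|[|i]]]]] hi] //; apply: sided_eq0;
    first [exact: (zchord_meet_r (cr _ hi))|apply: (zchord_meet_l (cr _ hi)); first [by left|by right]].
- by move=> [[|[|[|[|[|i]]]]] hi] //; apply: sided_eq0;
  [have h := cr 1%N isT|have h := cr 2%N isT|have h := cr 3%N isT|have h := cr 4%N isT|have h := cr 0%N isT];
    first [exact: (zchord_meet_r h)|apply: (zchord_meet_l h); first [by left|by right]].
- by move=> i j ji jS; apply: positive_edge.
Qed.

Lemma separator_gt0 (k i : nat) : (k < 4)%N -> (i < 5)%N -> (k, i) != (0%N, 1%N) ->
  0 < sided (nth e0 separators18 k) (corner18 i).
Proof.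
move=> k4 i5 ki; apply: positiveP; first by apply: (allP crosses18); rewrite mem_nth.
by move: k i k4 i5 ki => [|[|[|[|k]]]] [|[|[|[|[|i]]]]] //= _ _ _; vm_compute.
Qed.

Lemma separator_ge0 (k i : nat) : (k < 4)%N -> (i < 5)%N ->
  0 <= sided (nth e0 separators18 k) (corner18 i).
Proof.
move=> k4 i5; have [ki|ki] := eqVneq (k, i) (0%N, 1%N); last exact/ltW/separator_gt0.
by case: ki => -> ->; rewrite (sided_eq0 (l := nth e0 separators18 0)) // concurrent18.
Qed.

(** The sign of the sine of [m] times ten degrees, for [m] between -18 and 18. *)
Definition sign18 (m : Z) : Z :=
  if (m =? 18)%BZ || (m =? -18)%BZ then 0%BZ else Z.sgn m.
Definition excludes (l : bool * (Z * Z)) (a : Z) : bool :=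
  let x := (sign18 (a - l.2.1) * sign18 (a - l.2.2))%BZ in
  [&& small (a - l.2.1)%BZ, small (a - l.2.2)%BZ & if l.1 then (x <=? 0)%BZ else (0 <=? x)%BZ].

Lemma sign18P m : small m -> [/\ (sign18 m = 0)%BZ -> s (zR m) = 0,
  (sign18 m = 1)%BZ -> 0 < s (zR m) & (sign18 m = -1)%BZ -> s (zR m) < 0].
Proof.
move=> /andP[m1 m2]; rewrite /sign18.
have z18 : zR 18 = N by rewrite (zRE R 18) N18.
have zm18 : zR (-18) = - N by rewrite -z18 -zRN.
case: Z.eqb_spec => [->|n1]; first by split=> //; rewrite z18 sine_n.
case: Z.eqb_spec => [->|n2]; first by split=> //; rewrite zm18 sineN sine_n ?oppr0.
split=> /= h.
- have -> : m = 0%BZ by lia.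
  by rewrite zR0; exact: sine0.
- by apply: sine_gt0 => //; rewrite -z18 -[0](zR0 R); apply/andP; split; apply: zR_lt; lia.
- by apply: sine_lt0 => //; rewrite -zm18 -[0](zR0 R); apply/andP; split; apply: zR_lt; lia.
Qed.

Lemma sign18_cases m : small m -> [\/ sign18 m = 0%BZ, sign18 m = 1%BZ | sign18 m = (-1)%BZ].
Proof.
move=> _; rewrite /sign18; case: ifP => _; first by constructor 1.
by case: m => [|p|p] /=; [constructor 1|constructor 2|constructor 3].
Qed.

Lemma excludesP l a : excludes l a -> sided l (P (zR a)) <= 0.
Proof.
case: l => b [u v] /and3P[/= su sv].
have e : zchord (u, v) (P (zR a)) = s (zR (a - u)%BZ) * s (zR (a - v)%BZ).
  by rewrite /zchord /= chord_ngon // -!zRB.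
have -> : sided (b, (u, v)) (P (zR a)) = if b then zchord (u, v) (P (zR a)) else - zchord (u, v) (P (zR a)).
  by case: (b).
rewrite {}e.
have [u0 u1 u2] := sign18P su; have [w0 w1 w2] := sign18P sv.
have [su'|su'|su'] := sign18_cases su; have [sv'|sv'|sv'] := sign18_cases sv;
  rewrite su' sv'; case: b => //= _; rewrite ?oppr_le0;
  first [by rewrite (u0 su') mul0r|by rewrite (w0 sv') mulr0|by have := u1 su'; have := w1 sv'; nra
     |by have := u1 su'; have := w2 sv'; nra|by have := u2 su'; have := w1 sv'; nra
     |by have := u2 su'; have := w2 sv'; nra].
Qed.

(** A chord with both ends weakly outside of one line is outside of it
    altogether; evaluation finds such a line for each of the 18 * 18 chords. *)
Lemma excludes18 a b : (-4 <=? a)%BZ && (a <? 14)%BZ -> (-4 <=? b)%BZ && (b <? 14)%BZ ->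
  has (fun l => excludes l a && excludes l b) (edges18 ++ separators18).
Proof.
move=> ha hb.
have /allP/(_ (Z.to_nat (a + 4))) : all (fun i => all (fun j =>
  has (fun l => excludes l (Z.of_nat i - 4)%BZ && excludes l (Z.of_nat j - 4)%BZ) (edges18 ++ separators18)) (iota 0 18)) (iota 0 18)
  by vm_compute.
rewrite mem_iota => /(_ ltac:(lia)) /allP/(_ (Z.to_nat (b + 4))).
rewrite mem_iota => /(_ ltac:(lia)).
have -> : (Z.of_nat (Z.to_nat (a + 4)) - 4)%BZ = a by lia.
by have -> : (Z.of_nat (Z.to_nat (b + 4)) - 4)%BZ = b by lia.
Qed.

(** A chord through an interior point of the pentagon would be separated from
    it by an edge line, which is absurd, or by one of the other four lines,
    which are positive at interior points since they are nonnegative at the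
    corners. *)
Lemma pentagon18 : exists F, k_face 5 Dn F.
Proof.
apply: (chord_polygon_face n_ge3 r_gt0 (a := fun i : 'I_5 => zR (nth e0 edges18 i).2.1)
   (b := fun i : 'I_5 => zR (nth e0 edges18 i).2.2) polygon18).
- move=> i; split; try exact: zR_int.
  rewrite N18 -(zRE R 18) -zRD.
  by move: i => [[|[|[|[|[|i]]]]] hi] //; apply/andP; split; apply: zR_lt.
- by move=> i; rewrite /sided /zchord; case: (nth _ _ _).1; [left|right].
- move=> i; rewrite /corner18 /zmeet.
  have [h1 h2] := crossesP (allP crosses18 _ (mem_nth v0 (ltn_ord i : i < size corners18)%N)).
  by apply: inside_meet => //; exact: zR_int.
move=> z Dz; apply: contrapT => hz.
have {}hz (i : 'I_5) : 0 < sided (nth e0 edges18 i) z.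
  by rewrite ltNge; apply/negP => ?; apply: hz; exists i.
have zi : interior (conv_hull (range (fun i : 'I_5 => corner18 i))) z.
  by rewrite (polygon_interior polygon18).
have [a [b [aZ bZ /andP[a1 aN] /andP[b1 bN] zs]]] := drawing_window n_ge3 r_gt0 (zR_int R (-4)) Dz.
have [a' aE] := int_zR aZ; have [b' bE] := int_zR bZ; subst a b.
have lt_zR x y : zR x < zR y -> (x <? y)%BZ.
  by move=> xy; case: Z.ltb_spec => // /Z.leb_spec0/(@zR_le R _ _); rewrite leNgt xy.
have le_zR x y : zR x <= zR y -> (x <=? y)%BZ.
  by move=> xy; case: Z.leb_spec => // /Z.ltb_spec0/(@zR_lt R _ _); rewrite ltNge xy.
have e14 : zR (-4) + N = zR 14 by rewrite N18 -(zRE R 18) -zRD.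
rewrite e14 in aN bN.
have := @excludes18 a' b'; rewrite !le_zR// !lt_zR// => /(_ isT isT)/hasP[l lin /andP[la lb]].
have lz := affine_segment_le0 (sided_affine l) (excludesP la) (excludesP lb) zs.
move: lz; apply/negP; rewrite -ltNge; move: lin; rewrite mem_cat => /orP[] /(nthP e0)[k kl <-].
  exact: (hz (Ordinal kl)).
apply: affine_interior_gt0 (sided_affine _) _ (separator_gt0 kl (i := 0%N) isT _) zi => //.
  move=> y; apply: (conv_hull_sub (affine_cvx_ge (sided_affine _))).
  by move=> _ [i _ <-]; apply: separator_ge0.
by case: (k).
Qed.
End Eighteen.

(** * Exact subdivision of a polygon by lines *)
Section Quadratic.
Variable d : Z.
(** [(a, b)] stands for a + b sqrt d. *)
Definition quad : Type := (Z * Z)%type.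
Definition qadd (x y : quad) : quad := (x.1 + y.1, x.2 + y.2)%BZ.
Definition qopp (x : quad) : quad := (- x.1, - x.2)%BZ.
Definition qmul (x y : quad) : quad :=
  (x.1 * y.1 + d * (x.2 * y.2), x.1 * y.2 + x.2 * y.1)%BZ.
(** When the two terms have opposite signs, their squares are compared. *)
Definition qpos (x : quad) : bool :=
  let: (a, b) := x in
  (if (0 <=? a) && (0 <=? b) then (0 <? a) || (0 <? b)
   else if 0 <? a then d * (b * b) <? a * a
   else if 0 <? b then a * a <? d * (b * b) else false)%BZ.
Definition qnneg (x : quad) : bool := (x == (0, 0)%BZ) || qpos x.

(** Homogeneous coordinates, both for lines and for points. *)
Definition triple : Type := (quad * quad * quad)%type.
Definition qdot (l w : triple) : quad :=
  let: (a, b, c) := l in let: (x, y, z) := w in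
  qadd (qadd (qmul a x) (qmul b y)) (qmul c z).
Definition qsub (x y : quad) : quad := qadd x (qopp y).
Definition qcross (l m : triple) : triple :=
  let: (a, b, c) := l in let: (x, y, z) := m in
  (qsub (qmul b z) (qmul c y), qsub (qmul c x) (qmul a z), qsub (qmul a y) (qmul b x)).
Definition qneg (l : triple) : triple := let: (a, b, c) := l in (qopp a, qopp b, qopp c).

Definition triple0 : triple := ((0, 0), (0, 0), (0, 0))%BZ.
(** A polygon is the cyclic sequence of its edge lines; edge [i] starts where
    it meets the previous edge. *)
Definition vertex (poly : seq triple) (i : nat) : triple :=
  qcross (nth triple0 poly ((i + (size poly).-1) %% size poly)) (nth triple0 poly i).
Definition vertices (poly : seq triple) : seq triple := mkseq (vertex poly) (size poly).

(** The part of the polygon where [l] is positive: an edge is kept if it starts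
    or ends there, and [l] is inserted after the edge along which the polygon
    leaves that side.  As [leaf] tests the outcome, soundness rests on [clip_sub]
    alone. *)
Definition clip (poly : seq triple) (l : triple) : seq triple :=
  flatten (mkseq (fun i =>
    let e := nth triple0 poly i in
    let start := qpos (qdot l (vertex poly i)) in
    let stop := qpos (qdot l (vertex poly (i.+1 %% size poly))) in
    if start then (if stop then [:: e] else [:: e; l])
    else (if stop then [:: e] else [::])) (size poly)).

Definition cuts (l : triple) (poly : seq triple) : bool :=
  has (fun w => qpos (qdot l w)) (vertices poly) &&
  has (fun w => qpos (qdot (qneg l) w)) (vertices poly).

Definition one_sided (l : triple) (poly : seq triple) : bool :=
  all (fun w => qnneg (qdot l w)) (vertices poly) ||
  all (fun w => qnneg (qdot (qneg l) w)) (vertices poly).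

(** The test that certifies a cell: a convex polygon with three or four corners,
    cut out by given lines, and crossed by none of them. *)
Definition leaf (lines poly : seq triple) : bool :=
  let k := size poly in
  [&& (2 < k)%N, (k < 5)%N,
      all (fun w => qpos w.2) (vertices poly),
      all (fun i => all (fun j => [|| j == i, j == (i.+1 %% k)%N |
        qpos (qdot (nth triple0 poly i) (vertex poly j))]) (iota 0 k)) (iota 0 k),
      all (fun e => (e \in lines) || (qneg e \in lines)) poly
    & all (fun l => one_sided l poly) lines].

Fixpoint explore (lines ls poly : seq triple) : bool :=
  if ls is l :: ls' then
    if cuts l poly then explore lines ls' (clip poly l) && explore lines ls' (clip poly (qneg l))
    else explore lines ls' poly
  else leaf lines poly.

(** The third coordinate is 2 because the other two are twice the cosine and
    the sine of the vertex. *)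
Definition point (p : quad * quad) : triple := (p.1, p.2, (2, 0)%BZ).
Definition line_through (pts : seq (quad * quad)) (a b : nat) : triple :=
  qcross (point (nth ((0, 0), (0, 0))%BZ pts a)) (point (nth ((0, 0), (0, 0))%BZ pts b)).
Definition all_lines (pts : seq (quad * quad)) : seq triple :=
  [seq line_through pts a b | a <- iota 0 (size pts), b <- iota a.+1 (size pts - a.+1)].
Definition side_lines (pts : seq (quad * quad)) : seq triple :=
  mkseq (fun a => line_through pts a (a.+1 %% size pts)) (size pts).
Definition no_pentagon_check (pts : seq (quad * quad)) : bool :=
  explore (all_lines pts) (all_lines pts) (side_lines pts).
End Quadratic.

(** Twice the coordinates of the vertices, obtained by repeated rotation, [c]
    and [s] being twice the cosine and the sine of one turn.  The halving is
    exact in the cases of interest, as [rotation_check] verifies. *)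
Definition rotations (d : Z) (c s : quad) (n : nat) : seq (quad * quad) :=
  traject (fun p => let half (x : quad) : quad := (x.1 / 2, x.2 / 2)%BZ in
    (half (qsub (qmul d p.1 c) (qmul d p.2 s)), half (qadd (qmul d p.1 s) (qmul d p.2 c))))
    ((2, 0), (0, 0))%BZ n.

(** * Bounded faces without five corners *)
Section NoPentagon.
Variables (R : realType) (n : nat) (c : R * R) (r theta : R).
Hypotheses (n_ge3 : (2 < n)%N) (r_gt0 : 0 < r).
Variables (d : Z) (sq : R).
Hypotheses (sq_gt0 : 0 < sq) (sq_sqr : sq * sq = zR R d).
Local Notation pt := (R * R)%type.
Local Notation N := (n%:R : R).
Local Notation zR := (@zR R).
Local Notation s := (@sine R n).
Local Notation co := (@cosine R n).
Local Notation X := (abscissa c r theta).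
Local Notation Y := (ordinate c r theta).
Local Notation P := (ngon n c r theta).
Local Notation chord := (chord n c r theta).
Local Notation Dn := (ngon_drawing n c r theta).

Definition qval (x : quad) : R := zR x.1 + zR x.2 * sq.

Lemma qvalD x y : qval (qadd x y) = qval x + qval y.
Proof. by rewrite /qval /= !zRD; ring. Qed.
Lemma qvalN x : qval (qopp x) = - qval x.
Proof. by rewrite /qval /= !zRN; ring. Qed.
Lemma qvalB x y : qval (qsub x y) = qval x - qval y.
Proof. by rewrite qvalD qvalN. Qed.
Lemma qvalM x y : qval (qmul d x y) = qval x * qval y.
Proof. by rewrite /qval /= !(zRD, zRM) -sq_sqr; ring. Qed.

Lemma qval_gt0 x : qpos d x -> 0 < qval x.
Proof.
case: x => a b; rewrite /qpos /qval /=.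
have lt x y : (x <? y)%BZ -> zR x < zR y by exact: zR_lt.
have lt0 x : (0 <? x)%BZ -> 0 < zR x by rewrite -(zR0 R); exact: zR_lt.
have le0 x : (0 <=? x)%BZ -> 0 <= zR x by rewrite -(zR0 R); exact: zR_le.
have := sq_gt0 => sq0.
case: ifP => [/andP[/le0 a0 /le0 b0] /orP[/lt0|/lt0] h|_]; [nra|nra|].
case: ifP => [/lt0 a0 /lt|_].
  rewrite !zRM -sq_sqr => h; have [b0|b0] := leP 0 (zR b); first by nra.
  have : - (zR b * sq) < zR a; last lra.
  have bs : 0 <= - (zR b * sq) by nra.
  rewrite -ltr_sqr ?nnegrE //; [nra|exact: ltW].
case: ifP => // /lt0 b0 /lt; rewrite !zRM -sq_sqr => h.
have [a0|a0] := leP 0 (zR a); first by nra.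
have : - zR a < zR b * sq; last lra.
by rewrite -ltr_sqr ?nnegrE; [nra|lra|nra].
Qed.

Lemma qval_ge0 x : qnneg d x -> 0 <= qval x.
Proof.
move=> /orP[/eqP->|/qval_gt0/ltW//].
by rewrite /qval /= zR0; lra.
Qed.

Definition qev (l : triple) (z : pt) : R :=
  qval l.1.1 * X z + qval l.1.2 * Y z + qval l.2.

Lemma qev_affine l : affine (qev l).
Proof.
exists ((qval l.1.1 * cos theta - qval l.1.2 * sin theta) / r).
exists ((qval l.1.1 * sin theta + qval l.1.2 * cos theta) / r).
exists ((qval l.1.1 * (- c.1 * cos theta - c.2 * sin theta)
   + qval l.1.2 * (- c.2 * cos theta + c.1 * sin theta)) / r + qval l.2) => z.
by rewrite /qev /abscissa /ordinate; field; rewrite gt_eqF.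
Qed.

Lemma qev_neg l z : qev (qneg l) z = - qev l z.
Proof. by case: l => [[a b] e]; rewrite /qev /= !qvalN; ring. Qed.

(** The point of the plane with given homogeneous coordinates. *)
Definition place (w : triple) : pt :=
  let x := qval w.1.1 / qval w.2 in let y := qval w.1.2 / qval w.2 in
  (c.1 + r * (x * cos theta - y * sin theta), c.2 + r * (x * sin theta + y * cos theta)).

Lemma qev_place l w : 0 < qval w.2 -> qev l (place w) = qval (qdot d l w) / qval w.2.
Proof.
case: l w => [[a b] e] [[x y] z] /= z0; rewrite /qev /place /abscissa /ordinate /= !(qvalD, qvalM).
have rn : r != 0 by rewrite gt_eqF.
have zn : qval z != 0 by rewrite gt_eqF.
have t1 : cos theta ^+ 2 = 1 - sin theta ^+ 2 by rewrite cos2sin2.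
transitivity (qval a * (qval x / qval z * (cos theta ^+ 2 + sin theta ^+ 2))
  + qval b * (qval y / qval z * (cos theta ^+ 2 + sin theta ^+ 2)) + qval e).
  by field; rewrite zn rn.
by rewrite cos2Dsin2; field.
Qed.

Lemma qdot_crossl l m : qval (qdot d l (qcross d l m)) = 0.
Proof.
by case: l m => [[a b] e] [[x y] z]; rewrite /= !(qvalD, qvalB, qvalM); ring.
Qed.
Lemma qdot_crossr l m : qval (qdot d m (qcross d l m)) = 0.
Proof.
by case: l m => [[a b] e] [[x y] z]; rewrite /= !(qvalD, qvalB, qvalM); ring.
Qed.

Lemma vertex_in poly i : (i < size poly)%N -> vertex d poly i \in vertices d poly.
Proof. by move=> ik; apply/mapP; exists i; rewrite ?mem_iota. Qed.

Lemma leaf_polygon lines poly : leaf d lines poly ->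
  polygon (fun i : 'I_(size poly) => qev (nth triple0 poly i))
          (fun i : 'I_(size poly) => place (vertex d poly i)).
Proof.
move=> /and5P[k2 k5 /allP wpos /allP ev _].
have wp i : (i < size poly)%N -> 0 < qval (vertex d poly i).2.
  by move=> ik; apply/qval_gt0/wpos/vertex_in.
have k0 : (0 < size poly)%N by apply: leq_trans k2.
split=> //.
- by move=> i; exact: qev_affine.
- by move=> i; rewrite qev_place ?wp// qdot_crossr mul0r.
- move=> i; rewrite qev_place ?wp// /vertex /=.
  have -> : (((i.+1 %% size poly) + (size poly).-1) %% size poly)%N = i.
    rewrite modnDml addSnnS prednK // modnDr modn_small //.
  by rewrite qdot_crossl mul0r.
- move=> i j ji jS; rewrite qev_place ?wp// divr_gt0 ?wp//.
  apply: qval_gt0; have := ev i; rewrite mem_iota /= => /(_ (ltn_ord i))/allP/(_ j).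
  by rewrite mem_iota /= => /(_ (ltn_ord j))/or3P[/eqP/val_inj ij|/eqP ij|//];
    [rewrite ij eqxx in ji|move: jS; rewrite -val_eqE /= ij eqxx].
Qed.

Lemma clip_sub poly l e : e \in clip d poly l -> (e \in poly) || (e == l).
Proof.
move=> /flattenP[t /mapP[i]]; rewrite mem_iota /= => ik ->.
have inp := mem_nth triple0 ik.
case: (qpos d _); case: (qpos d _); rewrite !inE.
- by move=> /eqP->; rewrite inp.
- by move=> /orP[/eqP->|/eqP->]; rewrite ?inp ?eqxx ?orbT.
- by move=> /eqP->; rewrite inp.
- by [].
Qed.

(** Following, at each cut, the side that contains [q] leads to a certified cell
    that contains [q]. *)
Lemma explore_leaf lines ls poly q : explore d lines ls poly ->
  (forall e, e \in poly -> 0 < qev e q) -> (forall l, l \in ls -> qev l q != 0) ->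
  exists2 poly', leaf d lines poly' & forall e, e \in poly' -> 0 < qev e q.
Proof.
elim: ls poly => [|l ls IH] poly /=; first by move=> h hp _; exists poly.
move=> + hp hl.
have hls l' : l' \in ls -> qev l' q != 0 by move=> h; apply: hl; rewrite inE h orbT.
case: ifP => _; last by move=> h; exact: IH h hp hls.
move=> /andP[h1 h2].
have lq : qev l q != 0 by apply: hl; rewrite mem_head.
have [lp|ln] := ltP 0 (qev l q).
  apply: IH h1 _ hls => e /clip_sub/orP[/hp//|/eqP->//].
apply: IH h2 _ hls => e /clip_sub/orP[/hp//|/eqP->].
by rewrite qev_neg oppr_gt0 lt_neqAle lq.
Qed.

Variable pts : seq (quad * quad).
Hypothesis pts_size : size pts = n.
Local Notation pts_nth := (nth ((0, 0), (0, 0))%BZ pts).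
Hypothesis pts_val : forall k, (k < n)%N ->
  qval (pts_nth k).1 = 2 * co (2 * k%:R) /\ qval (pts_nth k).2 = 2 * s (2 * k%:R).

(** Both sides vanish on the same line; the constant is checked by expressing
    the two angles through their sum and their difference. *)
Lemma qev_line a b z : (a < n)%N -> (b < n)%N ->
  qev (line_through d pts a b) z = 16 * s (b%:R - a%:R) * chord a%:R b%:R z.
Proof.
move=> an bn; have [xa ya] := pts_val an; have [xb yb] := pts_val bn.
rewrite /line_through /point.
move: (pts_nth a) (pts_nth b) xa ya xb yb => [x1 y1] [x2 y2] /= xa ya xb yb.
have v2 : qval (2, 0)%BZ = 2 by rewrite /qval /= (zRE R 2) zR0; ring.
rewrite /qev /= !(qvalB, qvalM) xa ya xb yb v2 /chord.
have [u uE] : exists u : R, u = b%:R - a%:R by eexists.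
have [w wE] : exists w : R, w = a%:R + b%:R by eexists.
have -> : 2 * a%:R = w - u :> R by rewrite wE uE; ring.
have -> : 2 * b%:R = w + u :> R by rewrite wE uE; ring.
rewrite -uE -wE {uE wE}.
rewrite !(sineB _ w u, sineD _ w u, cosineB _ w u, cosineD _ w u).
have hu := cosine2_sine2 n u; have hw := cosine2_sine2 n w; move: hu hw.
set su := s u; set cu := co u; set sw := s w; set cw := co w => hu hw.
by field: hu hw.
Qed.

Lemma chordDn a b z : chord a (b + N) z = - chord a b z.
Proof.
have e1 : b + N - a = b - a + N by ring.
have e2 : a + (b + N) = a + b + N by ring.
rewrite /chord e1 e2 sineDn // !cosineD cosine_n // sine_n //; ring.
Qed.

Lemma chordC a b z : chord a b z = chord b a z.
Proof. by rewrite /chord -[b - a]opprB cosineN [a + b]addrC. Qed.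

(** The last side, from vertex [n - 1] back to vertex 0, is [chord] with its
    second index lowered by [n], which reverses two signs. *)
Lemma side_gt0 z e : e \in side_lines d pts -> inside n c r theta z ->
  (forall a b : nat, (a < b < n)%N -> chord a%:R b%:R z != 0) -> 0 < qev e z.
Proof.
move=> /mapP[a]; rewrite mem_iota pts_size add0n => /= an -> iz nz.
have s1 : 0 < s 1 := sine1_gt0 R n_ge3.
have h : qev (line_through d pts a (a.+1 %% n)) z = 16 * s 1 * chord a%:R (a%:R + 1) z.
  have nn : (a.+1 %% n < n)%N by rewrite ltn_mod; exact: ltn_trans n_ge3.
  rewrite (qev_line _ an nn).
  have [h|h] := ltnP a.+1 n.
    by rewrite modn_small // -[a.+1%:R]natr1 [_ + 1 - _]addrC addKr.
  have aE : a.+1 = n by apply/eqP; rewrite eqn_leq an.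
  rewrite aE modnn.
  have -> : a%:R + 1 = 0 + N :> R by rewrite -aE -[a.+1%:R]natr1; ring.
  rewrite chordDn; have -> : 0 - a%:R = - (N - 1) :> R by rewrite -aE -[a.+1%:R]natr1; ring.
  by rewrite sineN sine_nB //; ring.
rewrite {}h; apply: mulr_gt0; first exact: mulr_gt0.
have iza := iz a%:R (natr_int _ a).
rewrite lt_neqAle iza andbT eq_sym.
have [h|h] := ltnP a.+1 n.
  by rewrite natr1; apply: nz; rewrite ltnSn.
have aE : a.+1 = n by apply/eqP; rewrite eqn_leq an.
have -> : a%:R + 1 = 0 + N :> R by rewrite -aE -[a.+1%:R]natr1; ring.
have -> : chord a%:R (0 + N) z = - chord 0%:R a%:R z.
  by rewrite chordDn chordC.
by rewrite oppr_eq0; apply: nz; move: n_ge3; lia.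
Qed.

Lemma all_linesP l : l \in all_lines d pts ->
  exists a b : nat, (a < b < n)%N /\ l = line_through d pts a b.
Proof.
move=> /allpairsPdep[a [b []]]; rewrite !mem_iota add0n pts_size /= => an bn ->.
by exists a, b; split=> //; lia.
Qed.

Lemma line_in a b : (a < b < n)%N -> line_through d pts a b \in all_lines d pts.
Proof.
move=> /andP[ab bn]; apply/allpairsPdep; exists a, b.
by rewrite !mem_iota pts_size /= ; split=> //; lia.
Qed.

Lemma drawing_on_line z : Dn z -> exists2 l, l \in all_lines d pts & qev l z = 0.
Proof.
move=> /(drawing_window n_ge3 r_gt0 (rpred0 _))[u [v [uZ vZ]]]; rewrite add0r => u0N v0N zs.
have nat_of w : w \is a Num.int -> 0 <= w < N -> exists2 k : nat, (k < n)%N & w = k%:R.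
  move=> /intrP[[k|k] ->] /andP[w0 wN]; last by move: w0; rewrite ler0z.
  by exists k => //; rewrite -(@ltr_nat R).
have [a an aE] := nat_of u uZ u0N; have [b bn bE] := nat_of v vZ v0N; subst u v.
have zero (a' b' k : nat) : (a' < n)%N -> (b' < n)%N -> k \in [:: a'; b'] -> qev (line_through d pts a' b') (P k%:R) = 0.
  move=> an' bn'; rewrite qev_line // chord_ngon // !inE => /orP[]/eqP->; rewrite subrr sine0; ring.
(* when [a = b] the point is a vertex, which lies on the line of some chord *)
have [k [k' [kk' ak bk]]] : exists k k' : nat, [/\ (k < k' < n)%N, a \in [:: k; k'] & b \in [:: k; k']].
  have [ab|ab|->] := ltngtP a b.
  - by exists a, b; rewrite !inE !eqxx ?orbT ab.
  - by exists b, a; rewrite !inE !eqxx ?orbT ab.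
  - have [b0|b0] := posnP b; [exists 0%N, 1%N|exists 0%N, b].
      by rewrite b0 !inE !eqxx /=; split=> //; exact: ltn_trans n_ge3.
    by rewrite !inE !eqxx !orbT b0.
have /andP[kk kn] := kk'.
exists (line_through d pts k k'); first exact: line_in.
by apply: affine_segment_eq0 (qev_affine _) _ _ zs; apply: zero => //; exact: ltn_trans kn.
Qed.

(** A bounded face stays inside the n-gon, because the outer half-plane of a
    side is an unbounded subset of the complement, and then avoids the lines of
    all chords.  It is thus the cell of any of its points, which the search
    certifies to have at most four corners. *)
Lemma no_pentagon (F : set pt) : no_pentagon_check d pts -> ~ k_face 5 Dn F.
Proof.
move=> chk [[q Dq FE] Fb [v [V [Vpol FV]]]].
have FE' : F = connected_component (~` Dn) q by [].
have Fq : F q by rewrite FE'; exact: connected_component_refl.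
have Fcomp z : F z -> F = connected_component (~` Dn) z.
  by rewrite FE' => zq; exact: same_connected_component.
have FD z : F z -> ~ Dn z by rewrite FE' => /connected_component_sub.
have Finside z : F z -> inside n c r theta z.
  move=> Fz a aZ; rewrite leNgt; apply/negP => neg.
  have caff : affine (chord a (a + 1)) by exact: chord_affine.
  have Dpos y : Dn y -> 0 <= chord a (a + 1) y.
    by move=> /(inside_drawing n_ge3 r_gt0)/(_ a aZ).
  have Ppos : 0 <= chord a (a + 1) (P 0).
    by apply: inside_ngon => //; exact: rpred0.
  by have := unbounded_component caff Dpos neg Ppos; rewrite -Fcomp.
have Fchord z (a b : nat) : F z -> (a < b < n)%N -> chord a%:R b%:R z != 0.
  move=> Fz /andP[ab bn]; apply/eqP => z0; apply: (FD z Fz).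
  exists a%:R, b%:R; split; rewrite ?natr_int //.
  apply: on_chord => //; rewrite ?natr_int //; last exact: Finside.
  by rewrite ltr_nat ab -natrD ltr_nat; lia.
have Fline z l : F z -> l \in all_lines d pts -> qev l z != 0.
  move=> Fz /all_linesP[a [b [ab ->]]]; have /andP[ab' bn] := ab.
  have an := ltn_trans ab' bn.
  have sab : 0 < s (b%:R - a%:R).
    by rewrite sine_gt0 // subr_gt0 ltr_nat ab' /= ltrBlDr -natrD ltr_nat; lia.
  rewrite (qev_line z an bn); apply: mulf_neq0; last exact: Fchord.
  by rewrite gt_eqF // mulr_gt0.
have qside e : e \in side_lines d pts -> 0 < qev e q.
  by move=> es; apply: (side_gt0 es (Finside q Fq)) => i j; exact: Fchord.
have [poly lf polyq] := explore_leaf chk qside (fun l => @Fline q l Fq).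
have pol := leaf_polygon lf.
have /and5P[k2 k5 _ _ /andP[/allP el /allP lw]] := lf.
pose I := {l : triple | l \in all_lines d pts}.
have FW : F = interior (conv_hull (range (fun i : 'I_(size poly) => place (vertex d poly i)))).
  apply: (@arrangement_polygon R I (fun i => qev (sval i)) Dn F q _ _ FE' _ Dq _ _ _ pol).
  - by move=> i; exact: qev_affine.
  - by move=> z /drawing_on_line[l lin lz]; exists (exist _ l lin).
  - by move=> z [l lin] Fz; exact: Fline.
  - by move=> i; apply: polyq; rewrite mem_nth.
  - move=> i; have /orP[h|h] := el _ (mem_nth triple0 (ltn_ord i)).
      by exists (exist (fun l : triple => l \in all_lines d pts) _ h); left.
    exists (exist (fun l : triple => l \in all_lines d pts) _ h); right; apply/funext => z /=; rewrite qev_neg opprK //.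
  - move=> [l lin] /=.
    have wpos i : (i < size poly)%N -> 0 < qval (vertex d poly i).2.
      by move=> ik; move: lf => /and5P[_ _ /allP w _ _]; apply/qval_gt0/w/vertex_in.
    have nonneg l' (i : 'I_(size poly)) : qnneg d (qdot d l' (vertex d poly i)) ->
        0 <= qev l' (place (vertex d poly i)).
      move=> lw'; rewrite qev_place ?wpos //.
      exact: divr_ge0 (qval_ge0 lw') (ltW (wpos _ (ltn_ord i))).
    have /orP[/allP h|/allP h] := lw l lin; [left|right] => i.
      by apply: nonneg; apply: h; exact: vertex_in.
    by rewrite -oppr_ge0 -qev_neg; apply: nonneg; apply: h; exact: vertex_in.
have := @convex_polygon_size R 5 (size poly) v _ V Vpol _ (etrans (esym FV) FW).
by rewrite leqNgt k5 -FV => /(_ (ex_intro _ q Fq)).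
Qed.
End NoPentagon.

Definition rotation_check (d : Z) (c s : quad) (pts : seq (quad * quad)) : bool :=
  let p k := nth ((0, 0), (0, 0))%BZ pts k in
  (p 0%N == ((2, 0), (0, 0))%BZ) &&
  all (fun k =>
    (qmul d (2, 0)%BZ (p k.+1).1 == qsub (qmul d (p k).1 c) (qmul d (p k).2 s)) &&
    (qmul d (2, 0)%BZ (p k.+1).2 == qadd (qmul d (p k).1 s) (qmul d (p k).2 c)))
    (iota 0 (size pts).-1).

(** One step of the list is a rotation by one turn, that is, the addition
    formulas; the factor 2 of [rotation_check] stands for an exact halving. *)
Lemma rotation_values (R : realType) (n : nat) (d : Z) (sq : R) (qc qs : quad)
    (pts : seq (quad * quad)) : (0 < n)%N -> sq * sq = zR R d -> size pts = n ->
  rotation_check d qc qs pts ->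
  qval sq qc = 2 * cosine n 2 -> qval sq qs = 2 * sine n 2 ->
  forall k, (k < n)%N ->
    qval sq (nth ((0, 0), (0, 0))%BZ pts k).1 = 2 * cosine n (2 * k%:R) /\
    qval sq (nth ((0, 0), (0, 0))%BZ pts k).2 = 2 * sine n (2 * k%:R).
Proof.
move=> n0 sqE sz /andP[/eqP p0 /allP step] cE sE.
have v2 : qval sq (2, 0)%BZ = 2 by rewrite /qval /= (zRE R 2) zR0; ring.
elim=> [|k IH] kn.
  rewrite p0 v2 mulr0n mulr0 sine0; split; last by rewrite /qval /= zR0; ring.
  by rewrite /cosine mul0r cos0 mulr1.
have [h1 h2] := IH (ltnW kn).
have := step k; rewrite mem_iota sz add0n /= => /(_ _)/andP[|/eqP/(congr1 (qval sq)) e1 /eqP/(congr1 (qval sq)) e2].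
  by rewrite -ltnS prednK.
move: e1 e2; rewrite !(qvalB, qvalD, qvalM sqE) v2 cE sE h1 h2 => e1 e2.
have -> : 2 * k.+1%:R = 2 * k%:R + 2 :> R by rewrite -[k.+1%:R]natr1; ring.
have two : 2 != 0 :> R by rewrite pnatr_eq0.
by rewrite (cosineD _ (2 * k%:R) 2) (sineD _ (2 * k%:R) 2); split; apply: (mulfI two); [rewrite e1|rewrite e2]; ring.
Qed.

Section SmallCases.
Variables (R : realType) (n : nat) (c : R * R) (r theta : R).
Hypotheses (n_ge3 : (2 < n)%N) (r_gt0 : 0 < r).
Local Notation s := (@sine R n).
Local Notation co := (@cosine R n).
Local Notation N := (n%:R : R).

Lemma eq_from_sqr (x y : R) : 0 <= x -> 0 <= y -> x * x = y * y -> x = y.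
Proof. by move=> x0 y0 h; apply/eqP; rewrite -(@eqrXn2 _ 2) // !expr2 h. Qed.

Lemma no_pentagon_rotation (d : Z) (qc qs : quad) (sq := Num.sqrt (zR R d)) :
  (0 <? d)%BZ ->
  (sq * sq = zR R d -> 0 < sq -> qval sq qc = 2 * co 2 /\ qval sq qs = 2 * s 2) ->
  rotation_check d qc qs (rotations d qc qs n) ->
  no_pentagon_check d (rotations d qc qs n) ->
  forall F, ~ k_face 5 (ngon_drawing n c r theta) F.
Proof.
move=> d0 vals rc chk F.
have zd : 0 < zR R d by rewrite -(zR0 R); exact: zR_lt.
have sq0 : 0 < sq by rewrite sqrtr_gt0.
have sqE : sq * sq = zR R d by rewrite -expr2 sqr_sqrtr ?ltW.
have [qcE qsE] := vals sqE sq0.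
have sz : size (rotations d qc qs n) = n by rewrite size_traject.
apply: (no_pentagon n_ge3 r_gt0 sq0 sqE sz _ chk).
exact: rotation_values (ltn_trans (isT : 0 < 2)%N n_ge3) sqE sz rc qcE qsE.
Qed.

Lemma half_angle : 2 * (co 2 * co 2) = 1 + co 4 /\ 2 * (s 2 * s 2) = 1 - co 4.
Proof.
have -> : 4 = 2 + 2 :> R by lra.
have h := cosine2_sine2 n (2 : R); rewrite expr2 in h.
by rewrite (cosineD _ (2 : R) 2) h; split; ring.
Qed.

(** The angle of one turn has its cosine and sine in Z[sqrt 3] / 2, and in
    Z[sqrt 2] / 2 for the octagon; the search is then run by evaluation. *)
Lemma no_pentagon_small F : n \in [:: 3; 4; 6; 8; 12]%N -> ~ k_face 5 (ngon_drawing n c r theta) F.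
Proof.
have s2p : 0 < s 2 := sine2_gt0 R n_ge3.
have z3 := zRE R 3; have z2 := zRE R 2; have z1 := zRE R 1; have z0 := zR0 R.
have zm1 : zR R (-1) = -1 by rewrite -[1]z1 -zRN.
have third := cosine_third R n_ge3; have half := cosine_half R n_ge3.
have [h1 h2] := half_angle.
rewrite !inE => /or4P[/eqP n3|/eqP n4|/eqP n6|/orP[/eqP n8|/eqP n12]].
- have N3 : N = 3 by rewrite n3.
  have c4 : co 4 = - 2^-1.
    have -> : 4 = N / 3 + N by rewrite N3; lra.
    by rewrite cosineD third sine_n // cosine_n //; lra.
  have c2 : co 2 < 0 by apply: cosine_lt0; rewrite // N3; lra.
  apply: (@no_pentagon_rotation 3 (-1, 0)%BZ (0, 1)%BZ) => //;
    [|by rewrite n3; vm_compute|by rewrite n3; vm_compute].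
  rewrite /qval /= z3 z1 zm1 z0 => sq2 sq0; split.
    have : - (2 * co 2) = 1 by apply: eq_from_sqr; [lra|lra|nra].
    by lra.
  by rewrite mul1r add0r; apply: eq_from_sqr; [lra|lra|nra].
- have N4 : N = 4 by rewrite n4.
  have c2 : co 2 = 0 by rewrite -half N4; congr cosine; lra.
  have c4 : co 4 = -1 by rewrite -N4 cosine_n.
  apply: (@no_pentagon_rotation 3 (0, 0)%BZ (2, 0)%BZ) => //;
    [|by rewrite n4; vm_compute|by rewrite n4; vm_compute].
  rewrite /qval /= z2 z0 c2 => sq2 sq0; split; first by ring.
  by rewrite mul0r addr0; apply: eq_from_sqr; [lra|lra|nra].
- have N6 : N = 6 by rewrite n6.
  have c2 : co 2 = 2^-1 by rewrite -third N6; congr cosine; lra.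
  have c4 : co 4 = - 2^-1 by rewrite c2 in h1; lra.
  apply: (@no_pentagon_rotation 3 (1, 0)%BZ (0, 1)%BZ) => //;
    [|by rewrite n6; vm_compute|by rewrite n6; vm_compute].
  rewrite /qval /= z3 z1 z0 c2 => sq2 sq0; split; first by lra.
  by rewrite mul1r add0r; apply: eq_from_sqr; [lra|lra|nra].
- have N8 : N = 8 by rewrite n8.
  have c4 : co 4 = 0 by rewrite -half N8; congr cosine; lra.
  have c2 : 0 < co 2 by apply: cosine_gt0; rewrite // N8; lra.
  apply: (@no_pentagon_rotation 2 (0, 1)%BZ (0, 1)%BZ) => //;
    [|by rewrite n8; vm_compute|by rewrite n8; vm_compute].
  rewrite /qval /= z2 z1 z0 mul1r add0r => sq2 sq0.
  by split; apply: eq_from_sqr; first [lra|nra].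
- have N12 : N = 12 by rewrite n12.
  have c4 : co 4 = 2^-1 by rewrite -third N12; congr cosine; lra.
  have c2 : 0 < co 2 by apply: cosine_gt0; rewrite // N12; lra.
  apply: (@no_pentagon_rotation 3 (0, 1)%BZ (1, 0)%BZ) => //;
    [|by rewrite n12; vm_compute|by rewrite n12; vm_compute].
  rewrite /qval /= z3 z1 z0 mul1r mul0r add0r addr0 => sq2 sq0.
  by split; apply: eq_from_sqr; first [lra|nra].
Qed.
End SmallCases.

(** * At most two points, and the characterisation *)
Section Segment.
Variable R : realType.
Local Notation pt := (R * R)%type.

Lemma sum_squares_le0 (x y : R) : x * x + y * y <= 0 -> x = 0 /\ y = 0.
Proof.
have x2 := sqr_ge0 x; have y2 := sqr_ge0 y; rewrite !expr2 in x2 y2 => h.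
by split; apply/eqP; rewrite -sqrf_eq0 expr2; apply/eqP; lra.
Qed.

(** If [q] is off the line of the segment, that line separates; otherwise a
    perpendicular to it at one end does.  For a degenerate segment the
    perpendicular is taken to the direction of [q]. *)
Lemma segment_separation (a b q : pt) : ~ segment a b q ->
  exists f : pt -> R, [/\ affine f, 0 <= f a, 0 <= f b & f q < 0].
Proof.
case: a b q => [a1 a2] [b1 b2] [q1 q2] nq.
pose h1 := b1 - a1; pose h2 := b2 - a2.
pose g (z : pt) := h1 * (z.2 - a2) - h2 * (z.1 - a1).
pose m (z : pt) := h1 * (z.1 - a1) + h2 * (z.2 - a2).
have ga : affine g by exists (- h2), h1, (h2 * a1 - h1 * a2) => z; rewrite /g; ring.
have ma : affine m by exists h1, h2, (- h1 * a1 - h2 * a2) => z; rewrite /m; ring.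
have g0 : g (a1, a2) = 0 by rewrite /g /=; ring.
have g1 : g (b1, b2) = 0 by rewrite /g /h1 /h2 /=; ring.
have m0 : m (a1, a2) = 0 by rewrite /m /=; ring.
have m1 : m (b1, b2) = h1 * h1 + h2 * h2 by rewrite /m.
have [gq|gq|gq] := ltgtP (g (q1, q2)) 0.
- by exists g; rewrite g0 g1.
- exists (fun z => - g z); split; rewrite ?g0 ?g1 ?oppr0 //; first exact: affineN.
  by rewrite oppr_lt0.
have [hh|hh] := eqVneq (h1 * h1 + h2 * h2) 0.
  have [h10 h20] : h1 = 0 /\ h2 = 0 by apply: sum_squares_le0; rewrite hh.
  exists (fun z : pt => (a1 - q1) * (z.1 - a1) + (a2 - q2) * (z.2 - a2)); split => /=.
  - by exists (a1 - q1), (a2 - q2), (- (a1 - q1) * a1 - (a2 - q2) * a2) => z; ring.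
  - by rewrite !subrr; lra.
  - by rewrite -/h1 -/h2 h10 h20; lra.
  rewrite ltNge; apply/negP => neg; apply: nq; exists 0; rewrite /= ?lexx ?ler01 //.
  rewrite subr0 scale1r scale0r addr0.
  have [d1 d2] : a1 - q1 = 0 /\ a2 - q2 = 0 by apply: sum_squares_le0; lra.
  by congr pair; lra.
have hp : 0 < h1 * h1 + h2 * h2 by nra.
have [t0|t0] := ltP (m (q1, q2)) 0; first by exists m; split=> //; rewrite ?m0 ?m1; lra.
have [t1|t1] := ltP (h1 * h1 + h2 * h2) (m (q1, q2)).
  exists (fun z => - m z + (h1 * h1 + h2 * h2)); split; rewrite ?m0 ?m1; try lra.
  by apply: affineD; [exact: affineN|exists 0, 0, (h1 * h1 + h2 * h2) => z; ring].
exfalso; apply: nq; exists (m (q1, q2) / (h1 * h1 + h2 * h2)).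
  by apply/andP; split; rewrite ?divr_ge0 ?ler_pdivrMr ?mul1r // ltW.
have e1 : h1 * (q2 - a2) = h2 * (q1 - a1) by move: gq; rewrite /g /=; lra.
have t1E : m (q1, q2) / (h1 * h1 + h2 * h2) * h1 = q1 - a1.
  rewrite mulrAC; apply: (canLR (mulfK hh)); rewrite /m /=.
  transitivity (h1 * h1 * (q1 - a1) + h2 * (h1 * (q2 - a2))); first by ring.
  by rewrite e1; ring.
have t2E : m (q1, q2) / (h1 * h1 + h2 * h2) * h2 = q2 - a2.
  rewrite mulrAC; apply: (canLR (mulfK hh)); rewrite /m /=.
  transitivity (h1 * (h2 * (q1 - a1)) + h2 * h2 * (q2 - a2)); first by ring.
  by rewrite -e1; ring.
congr pair; rewrite /= /GRing.scale /=.
  by rewrite -[RHS](subrK a1) -t1E /h1; ring.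
by rewrite -[RHS](subrK a2) -t2E /h2; ring.
Qed.
End Segment.

Lemma segment_no_face (R : realType) (k : nat) (a b : R * R) (F : set (R * R)) :
  ~ k_face k (segment a b) F.
Proof.
move=> [[q Dq FE] Fb _]; have [f [fa fa0 fb0 fq]] := segment_separation Dq.
apply: (unbounded_component fa _ fq fa0 (D := segment a b)); last by rewrite FE.
by move=> z; exact: affine_segment_ge0.
Qed.

Unset Implicit Arguments.

Theorem theorem4 (R : realType) (n : nat) (n_gt0 : (0 < n)%N)
    (p : 'I_n -> R * R) (p_regular : regular_drawing p) :
  (exists F : set (R * R), k_face 5 (drawing_set p) F) <->
  (n \notin [:: 1; 2; 3; 4; 6; 8; 12])%N.
Proof.
have [_ [c [r [theta [r_gt0 rp]]]]] := p_regular.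
have [n_ge3|n_le2] := ltnP 2 n; last first.
  (* for [n = 1] the two vertices coincide and the segment is a point *)
  pose i0 : 'I_n := Ordinal n_gt0.
  have n1 : (n.-1 < n)%N by rewrite prednK.
  pose i1 : 'I_n := Ordinal n1.
  have ord_cases i : i = i0 \/ i = i1.
    have := ltn_ord i; case: (i =P i0) => [|ne]; [by left|right].
    by apply/val_inj => /=; move/eqP: ne; rewrite -val_eqE /=; lia.
  have DE : drawing_set p = segment (p i0) (p i1).
    have e0 x y : segment x y x by exists 0; rewrite /= ?lexx ?ler01 // subr0 scale1r scale0r addr0.
    apply/seteqP; split=> [z [[i _ <-]|[[i j] /= ij]]|z zs].
    - by have [->|->] := ord_cases i; [|apply: segmentC]; exact: e0.
    - by have [ei|ei] := ord_cases i; have [ej|ej] := ord_cases j;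
        rewrite ei ej ?eqxx // in ij *; exact: segmentC.
    have [e|ne] := eqVneq i0 i1; last by right; exists (i0, i1).
    move: zs; rewrite -e => -[t _ <-]; left; exists i0 => //.
    by rewrite -scalerDl subrK scale1r.
  split=> [[F]|]; first by rewrite DE => /segment_no_face.
  by move=> nn; exfalso; move: nn (n_gt0); rewrite !inE; lia.
rewrite (drawing_setE n_ge3 r_gt0 rp).
have [small|] := boolP (n \in [:: 3; 4; 6; 8; 12]%N).
  split=> [[F]|]; first by move/(no_pentagon_small n_ge3 r_gt0 small).
  by move=> nn; exfalso; move: small nn; rewrite !inE; lia.
move=> large; split=> [_|_].
  by move: large n_ge3; rewrite !inE; lia.
have [n18|n18] := eqVneq n 18%N; first exact: pentagon18.
apply: pentagon_exists => //; move: large n18; rewrite !inE; lia.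
Qed.
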